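(* Let $S$ be a Demoulin surface in the $3$-dimensional real projective space $\mathbb P^3$ with $bc\ne0$, given by a lift $f:\mathbb D\to\mathbb R^4\setminus\{\mathbf 0\}$ satisfying its canonical system, with Wilczynski frame $F$ (with values in $\mathrm{SL}_4\mathbb R$). Then its first-order Gauss map $g_1=FJ_1F^t:\mathbb D\to\mathcal Q=\mathrm{SL}_4\mathbb R/K_1$, which is conformal Lorentz harmonic, can be obtained by the natural projection of a Lorentz primitive map into the $6$-symmetric space $\mathrm{SL}_4\mathbb C/K$ with $$K=\{\mathrm{diag}(k_1,k_2,k_2^{-1},k_1^{-1})\mid k_1,k_2\in\mathbb C^\times\}.$$ That is, there is a Lorentz primitive map $g:\mathbb D\to\mathrm{SL}_4\mathbb C/K$ such that $\pi\circ g=g_1$, where $\pi:\mathrm{SL}_4\mathbb C/K\to\mathrm{SL}_4\mathbb C/K_1^{\mathbb C}$ is the natural projection and $\mathrm{SL}_4\mathbb R/K_1$ is regarded as a subset of $\mathrm{SL}_4\mathbb C/K_1^{\mathbb C}$.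
   Context: Surfaces. $\mathbb D\subset\mathbb R^2$ is a simply connected domain with coordinates $(x,y)$; all functions are smooth. A surface $S$ in $\mathbb P^3$ is represented by a lift $f:\mathbb D\to\mathbb R^4\setminus\{\mathbf 0\}$ satisfying the canonical system $$f_{xx}=b f_y+p f,\qquad f_{yy}=c f_x+q f,$$ where $b,c,p,q$ are real functions of $(x,y)$ and $f,f_x,f_y,f_{xy}$ are linearly independent at each point. The coordinates $(x,y)$ are asymptotic coordinates of $S$, and the Lorentz conformal structure on $\mathbb D$ induced by $S$ is that for which $x,y$ are null coordinates (the conformal class of $dx\,dy$). It is assumed that $bc\ne0$ everywhere. Invariants. Put $$P = p + \frac{b_y}{2} -\frac{c_{xx}}{2 c} + \frac{c_x^2}{4 c^2},\qquad Q = q + \frac{c_x}{2} - \frac{b_{yy}}{2 b}+ \frac{b_y^2}{4 b^2}.$$ $S$ is a Demoulin surface if $P=Q=0$ identically. Wilczynski frame. $F=(f,f_1,f_2,\eta)$ (columns) with $$f_1=f_x-\frac{c_x}{2c}f,\quad f_2=f_y-\frac{b_y}{2b}f,\quad \eta=f_{xy}-\frac{c_x}{2c}f_y-\frac{b_y}{2b}f_x+\Big(\frac{b_yc_x}{4bc}-\frac{bc}{2}\Big)f.$$ The determinant of $F$ is constant, and it is assumed throughout that $F$ takes values in $\mathrm{SL}_4\mathbb R$. First-order Gauss map. $J_1$ is the $4\times4$ matrix with entries $1$ on the anti-diagonal and $0$ elsewhere. $\mathcal Q$ is the space of real symmetric $4\times 4$ matrices of determinant one and signature $(2,2)$, on which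 $\mathrm{SL}_4\mathbb R$ acts transitively by $g\cdot p=gpg^t$; $\mathcal Q\cong\mathrm{SL}_4\mathbb R/K_1$ with $K_1=\{X\in\mathrm{SL}_4\mathbb R: XJ_1X^t=J_1\}$, the coset $XK_1$ corresponding to $XJ_1X^t$. Similarly $K_1^{\mathbb C}=\{X\in\mathrm{SL}_4\mathbb C: XJ_1X^t=J_1\}$. The first-order Gauss map is $g_1=FJ_1F^t:\mathbb D\to\mathcal Q$. $\mathcal Q$ carries the invariant pseudo-Riemannian metric $\langle X,Y\rangle_p=\mathrm{Tr}(p^{-1}Xp^{-1}Y)$. $g_1$ is conformal if $\langle (g_1)_x,(g_1)_x\rangle=\langle (g_1)_y,(g_1)_y\rangle=0$, and Lorentz harmonic if $\nabla_{\partial_x}(g_1)_y=0$, where $\nabla$ is the pullback of the Levi-Civita connection of $\mathcal Q$. The $6$-symmetric space. Let $\epsilon=e^{2\pi i/3}$, $E=\mathrm{diag}(1,\epsilon^2,\epsilon,1)$, and on $\mathrm{SL}_4\mathbb C$ let $\sigma(X)=EXE^{-1}$, $\tau_1(X)=J_1(X^t)^{-1}J_1$. These commute and $\kappa=\tau_1\circ\sigma$ is an automorphism of order six; $K$ is its fixed point group, and $\mathrm{SL}_4\mathbb C/K$ is the associated $6$-symmetric space. The derivative of $\kappa$ on $\mathfrak g=\mathfrak{sl}_4\mathbb C$ is $X\mapsto -J_1(EXE^{-1})^tJ_1$; $\mathfrak g_j$ denotes its eigenspace for the eigenvalue $(-\epsilon)^j$ ($j$ mod $6$; $-\epsilon$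 is a primitive $6$th root of unity). Lorentz primitive map. A map $g:\mathbb D\to\mathrm{SL}_4\mathbb C/K$ with frame (lift) $\Phi:\mathbb D\to\mathrm{SL}_4\mathbb C$ and $\alpha=\Phi^{-1}d\Phi=\alpha'+\alpha''$ ($\alpha'$ the $dx$-part, $\alpha''$ the $dy$-part) is Lorentz primitive if $\alpha'$ takes values in $\mathfrak g_0\oplus\mathfrak g_{-1}$ and $\alpha''$ takes values in $\mathfrak g_0\oplus\mathfrak g_1$. *)

(* Defs.v *)
From HB Require Import structures.
From mathcomp Require Import all_boot all_order all_algebra.
From mathcomp Require Import all_classical all_reals all_analysis.
From mathcomp Require Import complex.

Set Implicit Arguments.
Unset Strict Implicit.
Unset Printing Implicit Defensive.

Import Order.TTheory GRing.Theory Num.Theory.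
Import numFieldNormedType.Exports.

Local Open Scope classical_set_scope.
Local Open Scope ring_scope.

(* Functions on the domain [D] are total functions on [R * R]; only their
   restriction to the open set [D] matters. *)

Section Calculus.
Context {R : realType}.
Implicit Type D : set (R * R).

(* Nonempty, open, connected, and every loop in [D] is homotopic to a constant
   loop through loops in [D] with the same base point. *)
Definition simply_connected_domain D :=
  [/\ D !=set0, open D, connected D &
    forall gamma : R -> R * R,
      {within `[0, 1], continuous gamma} ->
      (forall t : R, t \in `[0, 1] -> D (gamma t)) ->
      gamma 0 = gamma 1 ->
      exists H : R * R -> R * R,
        [/\ {within `[0, 1] `*` `[0, 1], continuous H},
            forall s t : R, s \in `[0, 1] -> t \in `[0, 1] -> D (H (s, t)),
            forall t : R, t \in `[0, 1] ->
              H (0, t) = gamma t /\ H (1, t) = gamma 0 &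
            forall s : R, s \in `[0, 1] ->
              H (s, 0) = gamma 0 /\ H (s, 1) = gamma 0]].

Definition dx {V : normedModType R} (h : R * R -> V) : R * R -> V :=
  fun u => 'D_((1, 0) : R * R) h u.

Definition dy {V : normedModType R} (h : R * R -> V) : R * R -> V :=
  fun u => 'D_((0, 1) : R * R) h u.

Fixpoint Cn (n : nat) {V : normedModType R} D (h : R * R -> V) : Prop :=
  (forall u, D u -> {for u, continuous h}) /\
  if n is m.+1 then
    [/\ forall u, D u -> derivable h u ((1, 0) : R * R) /\
                         derivable h u ((0, 1) : R * R),
        Cn m D (dx h) & Cn m D (dy h)]
  else True.

Definition smooth {V : normedModType R} D (h : R * R -> V) : Prop :=
  forall n, Cn n D h.

(* Complex matrix-valued functions are differentiated through their real and
   imaginary parts. *)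
Definition Re_mx m n (M : 'M[R[i]]_(m, n)) : 'M[R]_(m, n) := map_mx (@complex.Re R) M.
Definition Im_mx m n (M : 'M[R[i]]_(m, n)) : 'M[R]_(m, n) := map_mx (@complex.Im R) M.
Definition complex_mx m n (A B : 'M[R]_(m, n)) : 'M[R[i]]_(m, n) :=
  map2_mx (@Complex R) A B.
Definition toC_mx m n (A : 'M[R]_(m, n)) : 'M[R[i]]_(m, n) :=
  map_mx (fun x : R => x%:C%C) A.

Definition smoothC m n D (h : R * R -> 'M[R[i]]_(m, n)) : Prop :=
  smooth D (fun u => Re_mx (h u)) /\ smooth D (fun u => Im_mx (h u)).

Definition dxC m n (h : R * R -> 'M[R[i]]_(m, n)) (u : R * R) :=
  complex_mx (dx (fun v => Re_mx (h v)) u) (dx (fun v => Im_mx (h v)) u).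

Definition dyC m n (h : R * R -> 'M[R[i]]_(m, n)) (u : R * R) :=
  complex_mx (dy (fun v => Re_mx (h v)) u) (dy (fun v => Im_mx (h v)) u).

End Calculus.

Section Surface.
Context {R : realType}.
Variables (b c p q : R * R -> R) (f : R * R -> 'cV[R]_4).

Definition canonical_system (u : R * R) : Prop :=
  dx (dx f) u = b u *: dy f u + p u *: f u /\
  dy (dy f) u = c u *: dx f u + q u *: f u.

Definition invP (u : R * R) : R :=
  p u + dy b u / 2 - dx (dx c) u / (2 * c u) + dx c u ^+ 2 / (4 * c u ^+ 2).

Definition invQ (u : R * R) : R :=
  q u + dx c u / 2 - dy (dy b) u / (2 * b u) + dy b u ^+ 2 / (4 * b u ^+ 2).

Definition wilczynski1 (u : R * R) : 'cV[R]_4 :=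
  dx f u - (dx c u / (2 * c u)) *: f u.

Definition wilczynski2 (u : R * R) : 'cV[R]_4 :=
  dy f u - (dy b u / (2 * b u)) *: f u.

Definition wilczynski_eta (u : R * R) : 'cV[R]_4 :=
  dy (dx f) u - (dx c u / (2 * c u)) *: dy f u - (dy b u / (2 * b u)) *: dx f u
  + (dy b u * dx c u / (4 * b u * c u) - b u * c u / 2) *: f u.

Definition wilczynski_frame (u : R * R) : 'M[R]_4 :=
  \matrix_(i, j)
    (tnth [tuple f u; wilczynski1 u; wilczynski2 u; wilczynski_eta u] j) i 0.

End Surface.

Definition J1 {T : pzRingType} : 'M[T]_4 :=
  \matrix_(i, j) (j == rev_ord i)%:R.

Section Quadrics.
Context {R : realType}.
Implicit Types (P X Y Z : 'M[R]_4) (D : set (R * R)).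

Definition signature22 P : Prop :=
  exists S : 'M[R]_4, S \in unitmx /\
    P = S *m diag_mx (\row_j [:: 1; 1; -1; -1]`_j) *m S^T.

Definition quadrics : set 'M[R]_4 :=
  [set P | [/\ P^T = P, \det P = 1 & signature22 P]].

(* The tangent space of [quadrics] at [P]: symmetric matrices in the kernel of
   the differential [X |-> \det P * \tr (P^-1 X)] of the determinant. *)
Definition tangent P : set 'M[R]_4 :=
  [set X | X^T = X /\ \tr (invmx P *m X) = 0].

Definition metric P X Y : R := \tr (invmx P *m X *m invmx P *m Y).

Definition first_order_gauss_map (F : R * R -> 'M[R]_4) (u : R * R) : 'M[R]_4 :=
  F u *m J1 *m (F u)^T.

(* A connection on the submanifold [quadrics] of the vector space of matrices is
   the flat derivative plus a bilinear correction [Gamma]; this is its covariant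
   derivative of the vector field [Y] along the curve [gamma]. *)
Definition nabla (Gamma : 'M[R]_4 -> 'M[R]_4 -> 'M[R]_4 -> 'M[R]_4)
    (gamma Y : R -> 'M[R]_4) (t : R) : 'M[R]_4 :=
  'D_1 Y t + Gamma (gamma t) ('D_1 gamma t) (Y t).

Definition differentiable_curve (gamma : R -> 'M[R]_4) : Prop :=
  forall t, derivable gamma t 1 /\ quadrics (gamma t).

Definition tangent_field (gamma Y : R -> 'M[R]_4) : Prop :=
  forall t, derivable Y t 1 /\ tangent (gamma t) (Y t).

(* [Gamma] defines a connection on [quadrics] (bilinearity, and covariant
   derivatives of tangent fields are tangent) that is torsion-free and metric,
   i.e. the Levi-Civita connection. The conditions along curves are of first
   order, so they do not depend on the regularity class of the curves. *)
Definition levi_civita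
    (Gamma : 'M[R]_4 -> 'M[R]_4 -> 'M[R]_4 -> 'M[R]_4) : Prop :=
  [/\ forall P, quadrics P -> forall (a : R) X Y Z,
        tangent P X -> tangent P Y -> tangent P Z ->
        Gamma P (a *: X + Y) Z = a *: Gamma P X Z + Gamma P Y Z,
      forall P, quadrics P -> forall X Y,
        tangent P X -> tangent P Y -> Gamma P X Y = Gamma P Y X,
      forall gamma (Y : R -> 'M[R]_4),
        differentiable_curve gamma -> tangent_field gamma Y ->
        forall t, tangent (gamma t) (nabla Gamma gamma Y t) &
      forall gamma (Y Z : R -> 'M[R]_4), differentiable_curve gamma ->
        tangent_field gamma Y -> tangent_field gamma Z ->
        forall t : R,
          'D_1 (fun s => metric (gamma s) (Y s) (Z s)) t =
          metric (gamma t) (nabla Gamma gamma Y t) (Z t) +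
          metric (gamma t) (Y t) (nabla Gamma gamma Z t)].

Definition conformal D (g : R * R -> 'M[R]_4) : Prop :=
  forall u, D u -> metric (g u) (dx g u) (dx g u) = 0 /\
                   metric (g u) (dy g u) (dy g u) = 0.

(* The covariant derivative along [x] of the vector field [g_y] along [g],
   for the pullback of the Levi-Civita connection, vanishes. The Levi-Civita
   connection is unique, so the choice of [Gamma] does not matter. *)
Definition lorentz_harmonic D (g : R * R -> 'M[R]_4) : Prop :=
  exists Gamma, levi_civita Gamma /\
    forall u, D u -> dx (dy g) u + Gamma (g u) (dx g u) (dy g u) = 0.

End Quadrics.

Section SixSymmetric.
Context {R : realType}.
Local Notation MC := 'M[R[i]]_4.
Implicit Types (X : MC) (D : set (R * R)).

(* [e^(2 pi i / 3)], by Euler's formula. *)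
Definition eps : R[i] := Complex (cos (2 * pi / 3)) (sin (2 * pi / 3)).

Definition E : MC := diag_mx (\row_j [:: 1; eps ^+ 2; eps; 1]`_j).

Definition sigma X : MC := E *m X *m invmx E.
Definition tau1 X : MC := J1 *m invmx X^T *m J1.
Definition kappa X : MC := tau1 (sigma X).
Definition dkappa X : MC := - (J1 *m (E *m X *m invmx E)^T *m J1).

Definition SL4C : set MC := [set X | \det X = 1].

Definition K : set MC := [set X | SL4C X /\ kappa X = X].

Definition K1C : set MC := [set X | SL4C X /\ X *m J1 *m X^T = J1].

Definition eigenspace_g (j : int) : set MC :=
  [set X | \tr X = 0 /\ dkappa X = (- eps) ^ j *: X].

Definition mulset (A B : set MC) : set MC := [set X *m Y | X in A & Y in B].

Definition addset (A B : set MC) : set MC := [set X + Y | X in A & Y in B].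

(* [SL4C / H], as the set of left cosets [X H]. *)
Definition cosets (H : set MC) : set (set MC) :=
  [set mulset [set X] H | X in SL4C].

(* Maps [X K] to [X K1C], since [K] is contained in [K1C]. *)
Definition proj_K_K1C (A : set MC) : set MC := mulset A K1C.

(* [quadrics] as a subset of [SL4C / K1C]: the real coset [X K1] corresponding
   to [P = X J1 X^T] is first formed, then sent to the complex coset [X K1C]. *)
Definition coset_of_quadric (P : 'M[R]_4) : set 'M[R]_4 :=
  [set X | \det X = 1 /\ X *m J1 *m X^T = P].

Definition quadric_to_K1C (P : 'M[R]_4) : set MC :=
  mulset [set toC_mx X | X in coset_of_quadric P] K1C.

Definition lorentz_primitive D (g : R * R -> set MC) : Prop :=
  exists Phi : R * R -> MC, smoothC D Phi /\
    forall u, D u ->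
      [/\ SL4C (Phi u), g u = mulset [set Phi u] K,
          addset (eigenspace_g 0) (eigenspace_g (-1))
            (invmx (Phi u) *m dxC Phi u) &
          addset (eigenspace_g 0) (eigenspace_g 1)
            (invmx (Phi u) *m dyC Phi u)].

End SixSymmetric.

(* Main.v *)
(** Write [a = c_x / 2c], [e = b_y / 2b], [k = bc / 2 - a_y], [l = bc / 2 - e_x].
    When [P = Q = 0] the canonical system becomes [F_x = F U], [F_y = F V] with
<<
      U = [a  0  l  -A]     V = [e  k  0  -B]     A = k_x + 2 a k,
          [1 -a  0   l]         [0  e  c   0]     B = l_y + 2 e l.
          [0  b  a   0]         [1  0 -e   k]
          [0  0  1  -a]         [0  1  0  -e]
>>
    Comparing the two mixed derivatives of the last column of [F] and using that
    the columns of [F] are independent gives [A = B = 0].  Then [U] lies in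
    [g_0 + g_(-1)] and [V] in [g_0 + g_1], so [F] itself, viewed as a complex
    matrix, frames a Lorentz primitive map that projects to [g1].
    Moreover [g1_x = 2 F W F^t] and [g1_y = 2 F W' F^t] with symmetric [W], [W'],
    where [U = diag(a, -a, a, -a) + W J1]; conformality says that [J1 W] and
    [J1 W'] have square of trace zero, and harmonicity follows from the
    Levi-Civita correction [- (X p^-1 Y + Y p^-1 X) / 2]. *)

Require Import Defs.
From mathcomp Require Import all_boot all_order all_algebra.
From mathcomp Require Import all_classical all_reals all_analysis.
From mathcomp Require Import complex perm.
From mathcomp Require Import ring lra.

Set Implicit Arguments.
Unset Strict Implicit.
Unset Printing Implicit Defensive.

Import Order.TTheory GRing.Theory Num.Theory.
Import numFieldNormedType.Exports.

Local Open Scope classical_set_scope.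
Local Open Scope ring_scope.

Local Notation o0 := (@Ordinal 4 0 isT).
Local Notation o1 := (@Ordinal 4 1 isT).
Local Notation o2 := (@Ordinal 4 2 isT).
Local Notation o3 := (@Ordinal 4 3 isT).

(** * Partial derivatives and smooth functions *)

Section DirectionalDerivative.
Context {R : realType} {V : normedModType R}.
Implicit Types (x v : V) (g h : V -> R).

Lemma is_derive_addf {W : normedModType R} (g h : V -> W) x v dg dh :
  is_derive x v g dg -> is_derive x v h dh ->
  is_derive x v (fun u => g u + h u) (dg + dh).
Proof. exact: is_deriveD. Qed.

Lemma is_derive_subf {W : normedModType R} (g h : V -> W) x v dg dh :
  is_derive x v g dg -> is_derive x v h dh ->
  is_derive x v (fun u => g u - h u) (dg - dh).
Proof. exact: is_deriveB. Qed.

Lemma is_derive_mulf g h x v (dg dh : R) :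
  is_derive x v g dg -> is_derive x v h dh ->
  is_derive x v (fun u => g u * h u) (dg * h x + g x * dh).
Proof.
move=> Dg Dh; have := is_deriveM Dg Dh.
by move=> /is_derive_eq; apply; rewrite /GRing.scale /= addrC mulrC.
Qed.

Lemma is_derive_invf g x v (dg : R) : g x != 0 ->
  is_derive x v g dg -> is_derive x v (fun u => (g u)^-1) (- dg / g x ^+ 2).
Proof.
move=> gx0 [Dg <-]; apply: DeriveDef; first exact: derivableV.
by rewrite deriveV // /GRing.scale /= mulNr mulNr mulrC.
Qed.

Lemma is_derive_line (W : normedModType R) (h : V -> W) x v (t : R) :
  derivable h (t *: v + x) v ->
  is_derive t 1 (fun s : R => h (s *: v + x)) ('D_v h (t *: v + x)).
Proof.
have E : (fun s : R => s^-1 *: (((fun s : R => h (s *: v + x)) \o shift t) (s *: 1)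
            - h (t *: v + x))) =
         (fun s : R => s^-1 *: ((h \o shift (t *: v + x)) (s *: v) - h (t *: v + x))).
  by apply/funext => s /=; rewrite scalerDl scaler1 -addrA.
by move=> Dh; split; rewrite /derivable /derive E.
Qed.

End DirectionalDerivative.

Section MixedDerivatives.
Context {R : realType} {V : normedModType R}.
Implicit Types (x v w : V) (h : V -> R).

(* The mean value theorem, applied once in each direction. *)
Lemma second_difference_MVT h x v w (s : R) : 0 < s ->
  (forall a b : R, 0 <= a <= s -> 0 <= b <= s ->
     derivable h (a *: v + (b *: w + x)) v /\
     derivable ('D_v h) (a *: v + (b *: w + x)) w) ->
  exists a b : R, [/\ 0 <= a <= s, 0 <= b <= s &
    h (s *: v + (s *: w + x)) - h (s *: v + x) - (h (s *: w + x) - h x) =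
    s * s * 'D_w ('D_v h) (a *: v + (b *: w + x))].
Proof.
move=> s0 Dh.
have s01 : 0 <= s <= s by rewrite lexx ltW.
have cc (t : R) : t \in `[0, s] -> 0 <= t <= s by rewrite in_itv.
have oo (t : R) : t \in `]0, s[ -> 0 <= t <= s.
  by rewrite in_itv /= => /andP[t0 ts]; rewrite !ltW.
have z01 : 0 <= (0 : R) <= s by rewrite lexx ltW.
pose phi (t : R) := h (t *: v + (s *: w + x)) - h (t *: v + (0 *: w + x)).
have Dphi t : 0 <= t <= s -> is_derive t 1 phi
    ('D_v h (t *: v + (s *: w + x)) - 'D_v h (t *: v + (0 *: w + x))).
  move=> ts; have [d1 _] := Dh t s ts s01; have [d0 _] := Dh t 0 ts z01.
  exact: is_derive_subf (is_derive_line d1) (is_derive_line d0).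
have [a] := @MVT_segment _ phi _ 0 s (ltW s0)
  (fun t ts => Dphi t (oo t ts)) (derivable_within_continuous (fun t ts =>
     @ex_derive _ _ _ _ _ _ _ (Dphi t (cc t ts)))).
rewrite in_itv /= => as01 Ea.
pose psi (t : R) := 'D_v h (a *: v + (t *: w + x)).
have Epsi : psi = fun t : R => 'D_v h (t *: w + (a *: v + x)).
  by apply/funext => t; rewrite /psi addrCA.
have Dpsi t : 0 <= t <= s -> is_derive t 1 psi
    ('D_w ('D_v h) (a *: v + (t *: w + x))).
  move=> ts; rewrite Epsi addrCA; apply: is_derive_line.
  by rewrite addrCA; have [] := Dh a t as01 ts.
have [b] := @MVT_segment _ psi _ 0 s (ltW s0)
  (fun t ts => Dpsi t (oo t ts)) (derivable_within_continuous (fun t ts =>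
     @ex_derive _ _ _ _ _ _ _ (Dpsi t (cc t ts)))).
rewrite in_itv /= => bs01 Eb.
exists a, b; split => //.
move: Ea Eb; rewrite /phi /psi !scale0r !add0r !subr0 => -> ->.
by rewrite mulrC mulrA mulrAC -mulrA mulrC.
Qed.

Lemma nbhs_parallelogram x v w (A : set V) : nbhs x A ->
  exists2 s : R, 0 < s & forall a b : R, 0 <= a <= s -> 0 <= b <= s ->
    A (a *: v + (b *: w + x)).
Proof.
move=> /nbhs_ballP[r /= r0 rA].
have n0 : 0 < `|v| + `|w| + 1 by rewrite ltr_wpDl ?addr_ge0.
exists (r / (`|v| + `|w| + 1)); first exact: divr_gt0.
move=> a b /andP[a0 as1] /andP[b0 bs1]; apply: rA.
rewrite -ball_normE /= distrC addrA addrK.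
apply: le_lt_trans (ler_normD _ _) _; rewrite !normrZ !ger0_norm //.
have : a * `|v| <= r / (`|v| + `|w| + 1) * `|v| by rewrite ler_wpM2r.
have : b * `|w| <= r / (`|v| + `|w| + 1) * `|w| by rewrite ler_wpM2r.
have : r / (`|v| + `|w| + 1) * (`|v| + `|w| + 1) = r by rewrite divfK ?gt_eqF.
have : 0 < r / (`|v| + `|w| + 1) by rewrite divr_gt0.
lra.
Qed.

Lemma derive_comm h x v w :
  (\forall y \near x, [/\ derivable h y v, derivable h y w,
     derivable ('D_v h) y w & derivable ('D_w h) y v]) ->
  {for x, continuous ('D_w ('D_v h))} -> {for x, continuous ('D_v ('D_w h))} ->
  'D_v ('D_w h) x = 'D_w ('D_v h) x.
Proof.
move=> Dh cvw cwv; apply/eqP; rewrite -subr_eq0 -normr_le0.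
apply/ler_addgt0Pr => e e0; rewrite add0r.
have e20 : 0 < e / 2 by rewrite divr_gt0.
have /cvgrPdist_lt /(_ _ e20) n1 := cvw.
have /cvgrPdist_lt /(_ _ e20) n2 := cwv.
have [s s0 H] := nbhs_parallelogram v w (filterI Dh (filterI n1 n2)).
have swap (k l : R) : k *: w + (l *: v + x) = l *: v + (k *: w + x).
  exact: addrCA.
have H' a b (as1 : 0 <= a <= s) (bs1 : 0 <= b <= s) :=
  eq_ind_r _ (H b a bs1 as1) (swap a b).
have [|a [b [as1 bs1 E1]]] := @second_difference_MVT h x v w s s0.
  by move=> a b as1 bs1; have [[]] := H a b as1 bs1.
have [|a' [b' [as2 bs2 E2]]] := @second_difference_MVT h x w v s s0.
  by move=> a' b' as2 bs2; have [[]] := H' a' b' as2 bs2.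
have [_ [+ _]] := H a b as1 bs1; have [_ [_ +]] := H' a' b' as2 bs2.
set p := 'D_v ('D_w h) (a' *: w + (b' *: v + x)).
have -> : 'D_w ('D_v h) (a *: v + (b *: w + x)) = p.
  apply: (mulfI (_ : s * s != 0)); first by rewrite mulf_neq0 ?gt_eqF.
  apply: etrans (esym E1) _; apply: etrans _ E2; rewrite (congr1 h (swap s s)).
  move: (h _) (h _) (h _) (h _) => k l m n; ring.
move: ('D_v ('D_w h) x) ('D_w ('D_v h) x) p => k l p h1 h2.
have -> : k - l = (k - p) - (l - p) by ring.
by apply: le_trans (ler_normB _ _) _; rewrite [e]splitr; apply: lerD; exact: ltW.
Qed.

End MixedDerivatives.

Section SmoothFunctions.
Context {R : realType}.
Implicit Types (D : set (R * R)) (n : nat).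

Lemma CnW n {V : normedModType R} D (h : R * R -> V) : Cn n.+1 D h -> Cn n D h.
Proof.
elim: n h => [|n IH] h [ch]; first by split.
by move=> [dh xh yh]; exact (conj ch (And3 dh (IH _ xh) (IH _ yh))).
Qed.

Lemma nbhs_open_eq {W : Type} D (h k : R * R -> W) u : open D -> D u ->
  {in D, h =1 k} -> \near u, h u = k u.
Proof.
move=> oD Du hk; near=> v; apply: hk; rewrite inE.
by near: v; exact: open_nbhs_nbhs.
Unshelve. all: by end_near. Qed.

Lemma Cn_eq n {V : normedModType R} D (h k : R * R -> V) :
  open D -> {in D, h =1 k} -> Cn n D h -> Cn n D k.
Proof.
move=> oD; elim: n h k => [|n IH] h k hk.
  case=> ch _; split=> // u Du.
  have hku : h u = k u by apply: hk; rewrite inE.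
  change (k @ u --> k u); rewrite -hku.
  exact: cvg_trans (near_eq_cvg (nbhs_open_eq oD Du hk)) (ch u Du).
case=> ch [dh xh yh].
have E e : {in D, (fun u => 'D_e h u) =1 fun u => 'D_e k u}.
  by move=> u /set_mem Du; exact: near_eq_derive (nbhs_open_eq oD Du hk).
split=> [u Du|].
  have hku : h u = k u by apply: hk; rewrite inE.
  change (k @ u --> k u); rewrite -hku.
  exact: cvg_trans (near_eq_cvg (nbhs_open_eq oD Du hk)) (ch u Du).
split=> [u Du||]; [|exact: IH (E _) xh|exact: IH (E _) yh].
by have [d1 d2] := dh u Du; split;
  apply: near_eq_derivable (nbhs_open_eq oD Du hk) _.
Qed.

Lemma Cn_cst n {V : normedModType R} D (a : V) : Cn n D (fun=> a).
Proof.
elim: n a => [|n IH] a; first by split=> // u _; exact: cvg_cst.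
split; first by move=> u _; exact: cvg_cst.
have E e : (fun u : R * R => 'D_e (fun=> a) u) = fun=> 0 :> V.
  by apply/funext => u; exact: derive_cst.
by split; [move=> u _; split; exact: derivable_cst| |];
  rewrite ?/dx ?/dy E; exact: IH.
Qed.

Lemma CnD n {V : normedModType R} D (h k : R * R -> V) : open D ->
  Cn n D h -> Cn n D k -> Cn n D (fun u => h u + k u).
Proof.
move=> oD; elim: n h k => [|n IH] h k.
  by move=> [ch _] [ck _]; split=> // u Du; apply: cvgD; [exact: ch|exact: ck].
move=> [ch [dh xh yh]] [ck [dk xk yk]]; split=> [u Du|].
  by apply: cvgD; [exact: ch|exact: ck].
split=> [u Du||].
- have [/derivableP hx /derivableP hy] := dh u Du.
  have [/derivableP kx /derivableP ky] := dk u Du.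
  split; [have [] := is_derive_addf hx kx|have [] := is_derive_addf hy ky]; by [].
- apply: Cn_eq (IH _ _ xh xk) => // u /set_mem Du.
  have [/derivableP hx _] := dh u Du; have [/derivableP kx _] := dk u Du.
  by have [_ <-] := is_derive_addf hx kx.
- apply: Cn_eq (IH _ _ yh yk) => // u /set_mem Du.
  have [_ /derivableP hy] := dh u Du; have [_ /derivableP ky] := dk u Du.
  by have [_ <-] := is_derive_addf hy ky.
Qed.

Lemma CnM n D (h k : R * R -> R) : open D ->
  Cn n D h -> Cn n D k -> Cn n D (fun u => h u * k u).
Proof.
move=> oD; elim: n h k => [|n IH] h k.
  by move=> [ch _] [ck _]; split=> // u Du; apply: cvgM; [exact: ch|exact: ck].
move=> Ch Ck; have Ch' := CnW Ch; have Ck' := CnW Ck.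
case: Ch => [ch [dh xh yh]]; case: Ck => [ck [dk xk yk]]; split=> [u Du|].
  by apply: cvgM; [exact: ch|exact: ck].
split=> [u Du||].
- have [/derivableP hx /derivableP hy] := dh u Du.
  have [/derivableP kx /derivableP ky] := dk u Du.
  split; [have [] := is_derive_mulf hx kx|have [] := is_derive_mulf hy ky]; by [].
- apply: Cn_eq (CnD oD (IH _ _ xh Ck') (IH _ _ Ch' xk)) => // u /set_mem Du.
  have [/derivableP hx _] := dh u Du; have [/derivableP kx _] := dk u Du.
  by have [_ <-] := is_derive_mulf hx kx.
- apply: Cn_eq (CnD oD (IH _ _ yh Ck') (IH _ _ Ch' yk)) => // u /set_mem Du.
  have [_ /derivableP hx] := dh u Du; have [_ /derivableP kx] := dk u Du.
  by have [_ <-] := is_derive_mulf hx kx.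
Qed.

Lemma CnV n D (h : R * R -> R) : open D -> (forall u, D u -> h u != 0) ->
  Cn n D h -> Cn n D (fun u => (h u)^-1).
Proof.
move=> oD h0; elim: n => [|n IH].
  by move=> [ch _]; split=> // u Du; apply: cvgV; [exact: h0|exact: ch].
move=> Ch; have /IH CV := CnW Ch.
case: Ch => [ch [dh xh yh]]; split=> [u Du|].
  by apply: cvgV; [exact: h0|exact: ch].
have CN (k : R * R -> R) : Cn n D k -> Cn n D (fun u => -1 * k u * ((h u)^-1 * (h u)^-1)).
  by move=> Ck; do ![apply: CnM => //]; exact: Cn_cst.
have E (e x : R) : -1 * e * (x^-1 * x^-1) = - e / x ^+ 2.
  by rewrite mulN1r -invfM -expr2.
split=> [u Du||].
- have [hx hy] := dh u Du.
  by split; [exact: derivableV (h0 u Du) hx|exact: derivableV (h0 u Du) hy].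
- apply: Cn_eq (CN _ xh) => // u /set_mem Du.
  have [/derivableP hx _] := dh u Du.
  by rewrite E; have [_ /esym] := is_derive_invf (h0 u Du) hx.
- apply: Cn_eq (CN _ yh) => // u /set_mem Du.
  have [_ /derivableP hx] := dh u Du.
  by rewrite E; have [_ /esym] := is_derive_invf (h0 u Du) hx.
Qed.

Lemma continuous_mxP {T : topologicalType} m n (M : T -> 'M[R]_(m, n)) u :
  {for u, continuous M} <-> forall i j, {for u, continuous (fun v => M v i j)}.
Proof.
split=> [cM i j|cM].
  by apply: (@continuous_comp _ _ _ M (fun A => A i j)) => //; exact: coord_continuous.
rewrite /continuous_at; apply/cvgrPdist_lt => e e0.
near=> v; rewrite [ltLHS]/Num.Def.normr /= mx_normrE.
apply: bigmax_lt => // -[i j] _; rewrite !mxE /=.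
move: i j; near: v; apply: filter_forall => i; apply: filter_forall => j.
exact: (cvgrPdist_lt _ _).1 (cM i j) e e0.
Unshelve. all: by end_near. Qed.

Lemma derive_mxE {V : normedModType R} m n (M : V -> 'M[R]_(m, n)) x v i j :
  derivable M x v -> 'D_v M x i j = 'D_v (fun u => M u i j) x.
Proof. by move=> DM; rewrite derive_mx // mxE. Qed.

Lemma Cn_mxP k m n D (M : R * R -> 'M[R]_(m, n)) : open D ->
  Cn k D M <-> forall i j, Cn k D (fun u => M u i j).
Proof.
move=> oD; elim: k M => [|k IH] M.
  split=> [[cM _] i j|cM]; split=> // u Du.
    by move/continuous_mxP : (cM u Du).
  by apply/continuous_mxP => i j; have [/(_ u Du)] := cM i j.
split=> [[cM [dM xM yM]] i j|cM].
  split=> [u Du|]; first by move/continuous_mxP : (cM u Du).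
  split=> [u Du||].
  - have [/derivable_mxP d1 /derivable_mxP d2] := dM u Du.
    by split; [exact: d1|exact: d2].
  - apply: Cn_eq ((IH _).1 xM i j) => // u /set_mem Du.
    by have [? _] := dM u Du; rewrite /dx derive_mxE.
  - apply: Cn_eq ((IH _).1 yM i j) => // u /set_mem Du.
    by have [_ ?] := dM u Du; rewrite /dy derive_mxE.
have dM u : D u -> derivable M u ((1, 0) : R * R) /\ derivable M u ((0, 1) : R * R).
  move=> Du; split; apply/derivable_mxP => i j;
    have [_ [/(_ u Du)[d1 d2] _ _]] := cM i j; [exact: d1|exact: d2].
split=> [u Du|].
  by apply/continuous_mxP => i j; have [/(_ u Du)] := cM i j.
split=> //; apply/IH => i j; have [_ [_ xM yM]] := cM i j.
- by apply: Cn_eq xM => // u /set_mem Du; rewrite {2}/dx derive_mxE //; have [] := dM u Du.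
- by apply: Cn_eq yM => // u /set_mem Du; rewrite {2}/dy derive_mxE //; have [] := dM u Du.
Qed.

Lemma smooth_eq {V : normedModType R} D (h k : R * R -> V) :
  open D -> {in D, h =1 k} -> smooth D h -> smooth D k.
Proof. by move=> oD hk sh n; exact: Cn_eq (sh n). Qed.

Lemma smooth_cst {V : normedModType R} D (a : V) : smooth D (fun=> a).
Proof. by move=> n; exact: Cn_cst. Qed.

Lemma smoothD {V : normedModType R} D (h k : R * R -> V) : open D ->
  smooth D h -> smooth D k -> smooth D (fun u => h u + k u).
Proof. by move=> oD sh sk n; exact: CnD. Qed.

Lemma smoothM D (h k : R * R -> R) : open D ->
  smooth D h -> smooth D k -> smooth D (fun u => h u * k u).
Proof. by move=> oD sh sk n; exact: CnM. Qed.

Lemma smoothB D (h k : R * R -> R) : open D ->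
  smooth D h -> smooth D k -> smooth D (fun u => h u - k u).
Proof.
move=> oD sh sk; have sN := smoothM oD (smooth_cst D (-1 : R)) sk.
by apply: smooth_eq (smoothD oD sh sN) => // u _; rewrite mulN1r.
Qed.

Lemma smoothV D (h : R * R -> R) : open D -> (forall u, D u -> h u != 0) ->
  smooth D h -> smooth D (fun u => (h u)^-1).
Proof. by move=> oD h0 sh n; exact: CnV. Qed.

Lemma smooth_dx {V : normedModType R} D (h : R * R -> V) :
  smooth D h -> smooth D (dx h).
Proof. by move=> sh n; have [_ []] := sh n.+1. Qed.

Lemma smooth_dy {V : normedModType R} D (h : R * R -> V) :
  smooth D h -> smooth D (dy h).
Proof. by move=> sh n; have [_ []] := sh n.+1. Qed.

Lemma smooth_is_dx {V : normedModType R} D (h : R * R -> V) u :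
  smooth D h -> D u -> is_derive u ((1, 0) : R * R) h (dx h u).
Proof.
by move=> sh Du; have [_ [/(_ u Du)[/derivableP d1 /derivableP d2] _ _]] := sh 1.
Qed.

Lemma smooth_is_dy {V : normedModType R} D (h : R * R -> V) u :
  smooth D h -> D u -> is_derive u ((0, 1) : R * R) h (dy h u).
Proof.
by move=> sh Du; have [_ [/(_ u Du)[/derivableP d1 /derivableP d2] _ _]] := sh 1.
Qed.

Lemma smooth_dxdy D (h : R * R -> R) u : open D -> D u -> smooth D h ->
  dx (dy h) u = dy (dx h) u.
Proof.
move=> oD Du sh; apply: derive_comm; last 2 first.
- by have [/(_ u Du)] := smooth_dy (smooth_dx sh) 0.
- by have [/(_ u Du)] := smooth_dx (smooth_dy sh) 0.
near=> v; have Dv : D v by near: v; exact: open_nbhs_nbhs.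
by split; apply: (@ex_derive _ _ _ _ _ _ _);
  [exact: smooth_is_dx sh Dv|exact: smooth_is_dy sh Dv|
   exact: smooth_is_dy (smooth_dx sh) Dv|exact: smooth_is_dx (smooth_dy sh) Dv].
Unshelve. all: by end_near. Qed.

Lemma smooth_is_dxdy D (h : R * R -> R) u : open D -> smooth D h -> D u ->
  is_derive u ((1, 0) : R * R) (dy h) (dy (dx h) u).
Proof.
move=> oD sh Du; rewrite -(smooth_dxdy oD Du sh).
exact: smooth_is_dx (smooth_dy sh) Du.
Qed.

Lemma smooth_is_dydx D (h : R * R -> R) u : open D -> smooth D h -> D u ->
  is_derive u ((0, 1) : R * R) (dx h) (dx (dy h) u).
Proof.
move=> oD sh Du; rewrite (smooth_dxdy oD Du sh).
exact: smooth_is_dy (smooth_dx sh) Du.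
Qed.

Lemma is_derive_eq_in {V : normedModType R} D (h k : R * R -> V) u e d :
  open D -> D u -> {in D, h =1 k} -> is_derive u e h d -> is_derive u e k d.
Proof. by move=> oD Du hk; exact: near_eq_is_derive (nbhs_open_eq oD Du hk). Qed.

Lemma smooth_mxP m n D (M : R * R -> 'M[R]_(m, n)) : open D ->
  smooth D M <-> forall i j, smooth D (fun u => M u i j).
Proof.
move=> oD; split=> [sM i j k|sM k]; first exact: (Cn_mxP k M oD).1.
by apply/Cn_mxP => // i j; exact: sM.
Qed.

End SmoothFunctions.

(** * The frame equations, one coordinate at a time *)

Section WilczynskiScalars.
Context {R : realType} (D : set (R * R)) (b c p q : R * R -> R).
Hypotheses (oD : open D) (sb : smooth D b) (sc : smooth D c).
Hypotheses (bc0 : forall u, D u -> b u * c u != 0).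

Lemma b_neq0 u : D u -> b u != 0.
Proof. by move=> /bc0; rewrite mulf_eq0 negb_or => /andP[]. Qed.

Lemma c_neq0 u : D u -> c u != 0.
Proof. by move=> /bc0; rewrite mulf_eq0 negb_or => /andP[]. Qed.

Definition frame_al (u : R * R) : R := dx c u / (2 * c u).
Definition frame_be (u : R * R) : R := dy b u / (2 * b u).
Definition frame_k (u : R * R) : R := b u * c u / 2 - dy frame_al u.
Definition frame_l (u : R * R) : R := b u * c u / 2 - dx frame_be u.
Local Notation al := frame_al.
Local Notation be := frame_be.
Local Notation k := frame_k.
Local Notation l := frame_l.

Lemma smooth_half_log (g dg : R * R -> R) : smooth D g -> smooth D dg ->
  (forall u, D u -> g u != 0) -> smooth D (fun u => dg u / (2 * g u)).
Proof.
move=> sg sdg g0; apply: smoothM => //; apply: smoothV => // [u /g0 ?|].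
  by rewrite mulf_neq0 // pnatr_eq0.
by apply: smoothM => //; exact: smooth_cst.
Qed.

Lemma smooth_al : smooth D al.
Proof. exact: smooth_half_log sc (smooth_dx sc) c_neq0. Qed.

Lemma smooth_be : smooth D be.
Proof. exact: smooth_half_log sb (smooth_dy sb) b_neq0. Qed.

Lemma smooth_k : smooth D k.
Proof.
apply: smoothB => //; last exact: smooth_dy smooth_al.
by apply: smoothM => //; [exact: smoothM|exact: smooth_cst].
Qed.

Lemma smooth_l : smooth D l.
Proof.
apply: smoothB => //; last exact: smooth_dx smooth_be.
by apply: smoothM => //; [exact: smoothM|exact: smooth_cst].
Qed.

Lemma is_derive_half_log (g dg : R * R -> R) u e (g' dg' : R) : g u != 0 ->
  is_derive u e g g' -> is_derive u e dg dg' ->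
  is_derive u e (fun v => dg v / (2 * g v))
    (dg' / (2 * g u) - dg u * g' / (2 * g u ^+ 2)).
Proof.
move=> g0 Dg Ddg.
have D2 : is_derive u e (fun v => 2 * g v) (0 * g u + 2 * g').
  exact: is_derive_mulf (is_derive_cst _ _ _) Dg.
have g20 : 2 * g u != 0 by rewrite mulf_neq0 // pnatr_eq0.
have DV := @is_derive_invf R _ (fun v => 2 * g v) _ _ _ g20 D2.
have /is_derive_eq := is_derive_mulf Ddg DV; apply.
by move: (g u) (dg u) g0 g20 => x y x0 x20; field.
Qed.

Lemma invPE u : D u -> invP b c p u = p u + b u * be u - dx al u - al u ^+ 2.
Proof.
move=> Du; have c0 := c_neq0 Du; have b0 := b_neq0 Du.
have [_ E] := is_derive_half_log c0 (smooth_is_dx sc Du) (smooth_is_dx (smooth_dx sc) Du).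
rewrite /invP [dx al u]E /al /be.
move: (b u) (c u) (p u) (dx c u) (dy b u) (dx (dx c) u) b0 c0.
by move=> x y z t v w x0 y0; field; rewrite x0 y0.
Qed.

Lemma invQE u : D u -> invQ b c q u = q u + c u * al u - dy be u - be u ^+ 2.
Proof.
move=> Du; have c0 := c_neq0 Du; have b0 := b_neq0 Du.
have [_ E] := is_derive_half_log b0 (smooth_is_dy sb Du) (smooth_is_dy (smooth_dy sb) Du).
rewrite /invQ [dy be u]E /al /be.
move: (b u) (c u) (q u) (dx c u) (dy b u) (dy (dy b) u) b0 c0.
by move=> x y z t v w x0 y0; field; rewrite x0 y0.
Qed.

Hypothesis PQ0 : forall u, D u -> invP b c p u = 0 /\ invQ b c q u = 0.

Definition frame_A u := dx k u + 2 * al u * k u.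
Definition frame_B u := dy l u + 2 * be u * l u.
Local Notation A := frame_A.
Local Notation B := frame_B.

Section Solution.
Variable h : R * R -> R.
Hypotheses (sh : smooth D h).
Hypothesis hxx : forall u, D u -> dx (dx h) u = b u * dy h u + p u * h u.
Hypothesis hyy : forall u, D u -> dy (dy h) u = c u * dx h u + q u * h u.

Definition sol1 u := dx h u - al u * h u.
Definition sol2 u := dy h u - be u * h u.
Definition sol_eta u := dy (dx h) u - al u * dy h u - be u * dx h u
  + (dy b u * dx c u / (4 * b u * c u) - b u * c u / 2) * h u.
Local Notation h1 := sol1.
Local Notation h2 := sol2.
Local Notation eta := sol_eta.

Lemma sol_etaE u : D u -> eta u = dy (dx h) u - al u * dy h u - be u * dx h u
  + (al u * be u - b u * c u / 2) * h u.
Proof.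
move=> Du; have c0 := c_neq0 Du; have b0 := b_neq0 Du.
rewrite /eta /al /be; congr (_ + (_ - _) * _).
move: (b u) (c u) (dx c u) (dy b u) b0 c0 => x y z t x0 y0.
by field; rewrite x0 y0.
Qed.

Lemma smooth_sol1 : smooth D h1.
Proof.
apply: smoothB => //; first exact: smooth_dx.
by apply: smoothM => //; exact: smooth_al.
Qed.

Lemma smooth_sol2 : smooth D h2.
Proof.
apply: smoothB => //; first exact: smooth_dy.
by apply: smoothM => //; exact: smooth_be.
Qed.

Lemma smooth_sol_eta : smooth D eta.
Proof.
have sx := smooth_dx sh; have sy := smooth_dy sh; have sxy := smooth_dy sx.
have sa := smooth_al; have se := smooth_be.
have s2 : smooth D (fun u => b u * c u / 2).
  by apply: smoothM => //; [exact: smoothM|exact: smooth_cst].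
apply: smooth_eq (smoothD oD (smoothB oD (smoothB oD sxy (smoothM oD sa sy))
  (smoothM oD se sx)) (smoothM oD (smoothB oD (smoothM oD sa se) s2) sh)) => //.
by move=> u /set_mem Du; rewrite sol_etaE.
Qed.

Lemma dx_sol u : dx h u = al u * h u + h1 u.
Proof. by rewrite /h1 addrC subrK. Qed.

Lemma dy_sol u : dy h u = be u * h u + h2 u.
Proof. by rewrite /h2 addrC subrK. Qed.

Lemma dx_sol1 u : D u -> dx h1 u = - al u * h1 u + b u * h2 u.
Proof.
move=> Du; have [P0 _] := PQ0 Du; move: P0; rewrite (invPE Du) => P0.
have [_ E] := is_derive_subf (smooth_is_dx (smooth_dx sh) Du)
  (is_derive_mulf (smooth_is_dx smooth_al Du) (smooth_is_dx sh Du)).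
rewrite [LHS]E hxx // /h1 /h2.
have {P0} -> : p u = dx al u + al u ^+ 2 - b u * be u by lra.
move: (b u) (dx al u) (al u) (be u) (h u) (dx h u) (dy h u); intros; ring.
Qed.

Lemma dy_sol1 u : D u -> dy h1 u = k u * h u + be u * h1 u + eta u.
Proof.
move=> Du.
have [_ E] := is_derive_subf (smooth_is_dy (smooth_dx sh) Du)
  (is_derive_mulf (smooth_is_dy smooth_al Du) (smooth_is_dy sh Du)).
rewrite [LHS]E sol_etaE // /h1 /k.
move: (b u * c u) (dy al u) (al u) (be u) (h u) (dx h u) (dy h u) (dy (dx h) u).
intros; lra.
Qed.

Lemma dx_sol2 u : D u -> dx h2 u = l u * h u + al u * h2 u + eta u.
Proof.
move=> Du.
have [_ E] := is_derive_subf (smooth_is_dxdy oD sh Du)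
  (is_derive_mulf (smooth_is_dx smooth_be Du) (smooth_is_dx sh Du)).
rewrite [LHS]E sol_etaE // /h2 /l.
move: (b u * c u) (dx be u) (al u) (be u) (h u) (dx h u) (dy h u) (dy (dx h) u).
intros; lra.
Qed.

Lemma dy_sol2 u : D u -> dy h2 u = c u * h1 u - be u * h2 u.
Proof.
move=> Du; have [_ Q0] := PQ0 Du; move: Q0; rewrite (invQE Du) => Q0.
have [_ E] := is_derive_subf (smooth_is_dy (smooth_dy sh) Du)
  (is_derive_mulf (smooth_is_dy smooth_be Du) (smooth_is_dy sh Du)).
rewrite [LHS]E hyy // /h1 /h2.
have {Q0} -> : q u = dy be u + be u ^+ 2 - c u * al u by lra.
move: (c u) (dy be u) (al u) (be u) (h u) (dx h u) (dy h u); intros; ring.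
Qed.

(* Differentiate [eta = h1_y - be h1 - k h] and use [h1_yx = h1_xy]. *)
Lemma dx_sol_eta u : D u -> dx eta u = - A u * h u + l u * h1 u - al u * eta u.
Proof.
move=> Du; have s1 := smooth_sol1.
have D1 := is_derive_subf
  (is_derive_mulf (smooth_is_dy sb Du) (smooth_is_dy smooth_sol2 Du))
  (is_derive_mulf (smooth_is_dy smooth_al Du) (smooth_is_dy s1 Du)).
have {D1} [|_ E1] := is_derive_eq_in oD Du _ D1 (k := dx h1).
  by move=> v /set_mem Dv; rewrite dx_sol1 //; ring.
have D2 := is_derive_subf (is_derive_subf (smooth_is_dxdy oD s1 Du)
  (is_derive_mulf (smooth_is_dx smooth_be Du) (smooth_is_dx s1 Du)))
  (is_derive_mulf (smooth_is_dx smooth_k Du) (smooth_is_dx sh Du)).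
have {D2} [|_ E2] := is_derive_eq_in oD Du _ D2 (k := eta).
  by move=> v /set_mem Dv; rewrite dy_sol1 //; ring.
rewrite [LHS]E2 [dy (dx h1) u]E1 dy_sol2 // dx_sol1 // dy_sol1 // dx_sol.
have -> : dy al u = b u * c u / 2 - k u by rewrite /k; lra.
have -> : dy b u = 2 * b u * be u.
  by rewrite /be; move: (b u) (dy b u) (b_neq0 Du) => x y x0; field.
rewrite /A /l.
move: (b u) (c u) (al u) (be u) (k u) (h u) (h1 u) (h2 u) (eta u) (dx be u) (dx k u).
intros; lra.
Qed.

Lemma dy_sol_eta u : D u -> dy eta u = - B u * h u + k u * h2 u - be u * eta u.
Proof.
move=> Du; have s2 := smooth_sol2.
have D1 := is_derive_subf
  (is_derive_mulf (smooth_is_dx sc Du) (smooth_is_dx smooth_sol1 Du))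
  (is_derive_mulf (smooth_is_dx smooth_be Du) (smooth_is_dx s2 Du)).
have {D1} [|_ E1] := is_derive_eq_in oD Du _ D1 (k := dy h2).
  by move=> v /set_mem Dv; rewrite dy_sol2.
have D2 := is_derive_subf (is_derive_subf (smooth_is_dydx oD s2 Du)
  (is_derive_mulf (smooth_is_dy smooth_al Du) (smooth_is_dy s2 Du)))
  (is_derive_mulf (smooth_is_dy smooth_l Du) (smooth_is_dy sh Du)).
have {D2} [|_ E2] := is_derive_eq_in oD Du _ D2 (k := eta).
  by move=> v /set_mem Dv; rewrite dx_sol2 //; ring.
rewrite [LHS]E2 [dx (dy h2) u]E1 dy_sol2 // dx_sol1 // dx_sol2 // dy_sol.
have -> : dx be u = b u * c u / 2 - l u by rewrite /l; lra.
have -> : dx c u = 2 * c u * al u.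
  by rewrite /al; move: (c u) (dx c u) (c_neq0 Du) => x y x0; field.
rewrite /B /k.
move: (b u) (c u) (al u) (be u) (l u) (h u) (h1 u) (h2 u) (eta u) (dy al u) (dy l u).
intros; lra.
Qed.

Lemma smooth_A : smooth D A.
Proof.
apply: smoothD => //; first exact: smooth_dx smooth_k.
apply: smoothM => //; last exact: smooth_k.
by apply: smoothM => //; [exact: smooth_cst|exact: smooth_al].
Qed.

Lemma smooth_B : smooth D B.
Proof.
apply: smoothD => //; first exact: smooth_dy smooth_l.
apply: smoothM => //; last exact: smooth_l.
by apply: smoothM => //; [exact: smooth_cst|exact: smooth_be].
Qed.

(* The equation [eta_xy = eta_yx] in the frame [(h, h1, h2, eta)]. *)
Lemma sol_compatibility u : D u ->
  (dx B u - dy A u + 2 * al u * B u - 2 * be u * A u) * h u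
  + 2 * B u * h1 u - 2 * A u * h2 u = 0.
Proof.
move=> Du; have sA := smooth_A; have sB := smooth_B.
have s1 := smooth_sol1; have s2 := smooth_sol2; have se := smooth_sol_eta.
have Dk : is_derive u ((1, 0) : R * R) k (A u - 2 * al u * k u).
  by rewrite /A addrK; exact: smooth_is_dx smooth_k Du.
have Dl : is_derive u ((0, 1) : R * R) l (B u - 2 * be u * l u).
  by rewrite /B addrK; exact: smooth_is_dy smooth_l Du.
have Dal : is_derive u ((0, 1) : R * R) al (b u * c u / 2 - k u).
  by rewrite /k subKr; exact: smooth_is_dy smooth_al Du.
have Dbe : is_derive u ((1, 0) : R * R) be (b u * c u / 2 - l u).
  by rewrite /l subKr; exact: smooth_is_dx smooth_be Du.
have hx := smooth_is_dx sh Du; rewrite dx_sol in hx.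
have hy := smooth_is_dy sh Du; rewrite dy_sol in hy.
have h1y := smooth_is_dy s1 Du; rewrite (dy_sol1 Du) in h1y.
have h2x := smooth_is_dx s2 Du; rewrite (dx_sol2 Du) in h2x.
have ex := smooth_is_dx se Du; rewrite (dx_sol_eta Du) in ex.
have ey := smooth_is_dy se Du; rewrite (dy_sol_eta Du) in ey.
have Dx := is_derive_subf (is_derive_subf (is_derive_mulf Dk h2x)
  (is_derive_mulf (smooth_is_dx sB Du) hx)) (is_derive_mulf Dbe ex).
have {Dx} [|_ Ex] := is_derive_eq_in oD Du _ Dx (k := dy eta).
  by move=> v /set_mem Dv; rewrite dy_sol_eta //; ring.
have Dy := is_derive_subf (is_derive_subf (is_derive_mulf Dl h1y)
  (is_derive_mulf (smooth_is_dy sA Du) hy)) (is_derive_mulf Dal ey).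
have {Dy} [|_ Ey] := is_derive_eq_in oD Du _ Dy (k := dx eta).
  by move=> v /set_mem Dv; rewrite dx_sol_eta //; ring.
have := etrans (esym Ex) (etrans (smooth_dxdy oD Du se) Ey).
move: (b u * c u / 2) (al u) (be u) (k u) (l u) (h u) (h1 u) (h2 u) (eta u) (A u) (B u)
  (dx B u) (dy A u) => bc2 a e k' l' x x1 x2 y a' b' bx ay /esym/eqP.
by rewrite -subr_eq0 => /eqP <-; ring.
Qed.

End Solution.
End WilczynskiScalars.

(** * Matrix calculus and the Levi-Civita connection *)

Section MatrixCalculus.
Context {R : realType} {V : normedModType R}.
Implicit Types x v : V.

Lemma is_derive_mxP m n (M : V -> 'M[R]_(m, n)) x v (dM : 'M[R]_(m, n)) :
  is_derive x v M dM <->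
  forall i j, is_derive x v (fun u => M u i j) (dM i j).
Proof.
split=> [[DM <-] i j|DM].
  rewrite derive_mxE //; apply: derivableP.
  by move/derivable_mxP : DM => /(_ i j).
have dM' : derivable M x v.
  by apply/derivable_mxP => i j; have [] := DM i j.
apply: DeriveDef => //; apply/matrixP => i j.
by rewrite derive_mxE //; have [_] := DM i j.
Qed.

Lemma is_derive_sumf (I : Type) (r : seq I) (h : I -> V -> R) x v (dh : I -> R) :
  (forall i, is_derive x v (h i) (dh i)) ->
  is_derive x v (fun u => \sum_(i <- r) h i u) (\sum_(i <- r) dh i).
Proof.
move=> Dh; elim: r => [|i r IH].
  rewrite big_nil (_ : (fun u => _) = fun=> 0); first exact: is_derive_cst.
  by apply/funext => u; rewrite big_nil.
rewrite big_cons (_ : (fun u => _) = fun u => h i u + \sum_(i <- r) h i u).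
  exact: is_derive_addf (Dh i) IH.
by apply/funext => u; rewrite big_cons.
Qed.

Lemma derivable_prodf (I : Type) (r : seq I) (h : I -> V -> R) x v :
  (forall i, derivable (h i) x v) ->
  derivable (fun u => \prod_(i <- r) h i u) x v.
Proof.
move=> Dh; elim: r => [|i r IH].
  rewrite (_ : (fun u => _) = fun=> 1); first exact: derivable_cst.
  by apply/funext => u; rewrite big_nil.
rewrite (_ : (fun u => _) = fun u => h i u * \prod_(i <- r) h i u).
  by have [] := is_derive_mulf (derivableP (Dh i)) (derivableP IH).
by apply/funext => u; rewrite big_cons.
Qed.

Lemma is_derive_mulmx m n p (M : V -> 'M[R]_(m, n)) (N : V -> 'M[R]_(n, p))
    x v dM dN :
  is_derive x v M dM -> is_derive x v N dN ->
  is_derive x v (fun u => M u *m N u) (dM *m N x + M x *m dN).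
Proof.
move=> /is_derive_mxP DM /is_derive_mxP DN; apply/is_derive_mxP => i j.
rewrite !mxE -big_split /= (_ : (fun u => _) = fun u => \sum_k M u i k * N u k j).
  by apply: is_derive_sumf => k; exact: is_derive_mulf (DM i k) (DN k j).
by apply/funext => u; rewrite mxE.
Qed.

Lemma is_derive_trmx m n (M : V -> 'M[R]_(m, n)) x v dM :
  is_derive x v M dM -> is_derive x v (fun u => (M u)^T) dM^T.
Proof.
move=> /is_derive_mxP DM; apply/is_derive_mxP => i j; rewrite mxE.
rewrite (_ : (fun u => _) = fun u => M u j i); first exact: DM.
by apply/funext => u; rewrite mxE.
Qed.

Lemma is_derive_mxtrace n (M : V -> 'M[R]_n) x v dM :
  is_derive x v M dM -> is_derive x v (fun u => \tr (M u)) (\tr dM).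
Proof.
by move=> /is_derive_mxP DM; apply: is_derive_sumf => i; exact: DM.
Qed.

Lemma derivable_det n (M : V -> 'M[R]_n) x v :
  (forall i j, derivable (fun u => M u i j) x v) ->
  derivable (fun u => \det (M u)) x v.
Proof.
move=> DM; rewrite /determinant.
have Dp (s : 'S_n) : is_derive x v (fun u => (-1) ^+ s * \prod_i M u i (s i))
    (0 * \prod_i M x i (s i) + (-1) ^+ s * 'D_v (fun u => \prod_i M u i (s i)) x).
  have Dprod : derivable (fun u => \prod_i M u i (s i)) x v by exact: derivable_prodf.
  exact: is_derive_mulf (is_derive_cst ((-1) ^+ s : R) x v) (derivableP Dprod).
by have [] := is_derive_sumf (index_enum _) Dp.
Qed.

Lemma is_derive_invmx n (M : V -> 'M[R]_n) x v dM :
  (forall u, \det (M u) = 1) -> is_derive x v M dM ->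
  is_derive x v (fun u => invmx (M u)) (- (invmx (M x) *m dM *m invmx (M x))).
Proof.
move=> M1 DM; have uM u : M u \in unitmx by rewrite unitmxE M1 unitr1.
have DI : derivable (fun u => invmx (M u)) x v.
  apply/derivable_mxP => i j.
  have -> : (fun u => invmx (M u) i j) =
      fun u => (-1) ^+ (j + i) * \det (row' j (col' i (M u))).
    by apply/funext => u; rewrite /invmx uM M1 invr1 scale1r mxE.
  have D' : derivable (fun u => \det (row' j (col' i (M u)))) x v.
    apply: derivable_det => k l.
    rewrite (_ : (fun u => _) = fun u => M u (lift j k) (lift i l)); last first.
      by apply/funext => u; rewrite !mxE.
    by move/is_derive_mxP : DM => /(_ (lift j k) (lift i l))[].
  by have [] := is_derive_mulf (is_derive_cst ((-1) ^+ (j + i) : R) x v) (derivableP D').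
have [_ E] := is_derive_mulmx DM (derivableP DI).
apply: DeriveDef => //.
have /(congr1 (fun A => invmx (M x) *m A)) : dM *m invmx (M x) +
    M x *m 'D_v (fun u => invmx (M u)) x = 0.
  rewrite -E (_ : (fun u => _) = fun=> 1%:M); first exact: derive_cst.
  by apply/funext => u; rewrite mulmxV.
rewrite mulmxDr mulKmx // mulmx0 => /eqP; rewrite addrC addr_eq0 => /eqP ->.
by rewrite mulmxA.
Qed.

End MatrixCalculus.

Section LeviCivita.
Context {R : realType}.
Implicit Types P X Y : 'M[R]_4.

Definition quadrics_gamma P X Y : 'M[R]_4 :=
  - 2^-1 *: (X *m invmx P *m Y + Y *m invmx P *m X).

Lemma levi_civita_quadrics_gamma : levi_civita quadrics_gamma.
Proof.
rewrite /quadrics_gamma; split.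
- move=> P _ a X Y Z _ _ _; rewrite !mulmxDl !mulmxDr.
  rewrite -!scalemxAl -!scalemxAr addrACA.
  by rewrite !scalerDr !scalerA (mulrC a).
- by move=> P _ X Y _ _; rewrite addrC.
- move=> gamma Y Dgamma DY t.
  have [/derivableP Dg [gT g1 _]] := Dgamma t; have [/derivableP Dy [YT _]] := DY t.
  have DN := is_derive_invmx (fun u => let: And3 _ e _ := (Dgamma u).2 in e) Dg.
  have sym M : (forall u, (M u)^T = M u) -> is_derive t 1 M ('D_1 M t) ->
      ('D_1 M t)^T = 'D_1 M t.
    move=> MT /is_derive_trmx; rewrite (_ : (fun u => _) = M); first by case.
    by apply/funext.
  have gT' := sym _ gamma (fun u => let: And3 e _ _ := (Dgamma u).2 in e) Dg.
  have YT' := sym _ Y (fun u => (DY u).2.1) Dy.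
  split.
    rewrite /nabla raddfD /= linearZ /= raddfD /= !trmx_mul trmx_inv gT gT' YT YT'.
    by rewrite !mulmxA [X in - _ *: X]addrC.
  have [_ E] := is_derive_mxtrace (is_derive_mulmx DN Dy).
  have {E} : \tr (- (invmx (gamma t) *m 'D_1 gamma t *m invmx (gamma t)) *m Y t
      + invmx (gamma t) *m 'D_1 Y t) = 0.
    rewrite -E (_ : (fun u => _) = fun=> 0); first exact: derive_cst.
    by apply/funext => u; have [_ []] := DY u.
  rewrite /nabla; move: (invmx (gamma t)) ('D_1 gamma t) ('D_1 Y t) (Y t).
  move=> N G Y' y.
  rewrite !(mulmxDr, mulNmx, =^~ scalemxAr) !mulmxA !(mxtraceD, mxtraceZ, raddfN) /=.
  have -> : \tr (N *m y *m N *m G) = \tr (N *m G *m N *m y).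
    by rewrite -[N *m y *m N *m G]mulmxA mxtrace_mulC !mulmxA.
  lra.
- move=> gamma Y Z Dgamma DY DZ t.
  have [/derivableP Dg [gT g1 _]] := Dgamma t.
  have [/derivableP Dy _] := DY t; have [/derivableP Dz _] := DZ t.
  have DN := is_derive_invmx (fun u => let: And3 _ e _ := (Dgamma u).2 in e) Dg.
  have [_ E] := is_derive_mxtrace (is_derive_mulmx (is_derive_mulmx (is_derive_mulmx DN Dy) DN) Dz).
  rewrite [LHS]E /metric /nabla.
  move: (invmx (gamma t)) ('D_1 gamma t) ('D_1 Y t) (Y t) ('D_1 Z t) (Z t).
  move=> N G Y' y Z' z.
  rewrite !(mulmxDr, mulmxDl, mulNmx, mulmxN, =^~ scalemxAr, =^~ scalemxAl) !mulmxA.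
  rewrite !(mxtraceD, mxtraceZ, raddfN) /=.
  have -> : \tr (N *m y *m N *m z *m N *m G) = \tr (N *m G *m N *m y *m N *m z).
    by rewrite -[N *m y *m N *m z *m N *m G]mulmxA mxtrace_mulC !mulmxA.
  lra.
Qed.

End LeviCivita.

(** * The 6-symmetric space *)

Lemma ord4P (P : 'I_4 -> Prop) : P o0 -> P o1 -> P o2 -> P o3 -> forall i, P i.
Proof.
move=> P0 P1 P2 P3 [[|[|[|[|//]]]] lt_i];
  by rewrite (bool_irrelevance lt_i isT).
Qed.

Lemma rev_ord4 :
  (rev_ord o0 = o3) * (rev_ord o1 = o2) * (rev_ord o2 = o1) * (rev_ord o3 = o0).
Proof. by do !split; exact/val_inj. Qed.

Lemma big_ord4 (T : Type) (idx : T) (op : Monoid.law idx) (F : 'I_4 -> T) :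
  \big[op/idx]_i F i = op (op (op (F o0) (F o1)) (F o2)) (F o3).
Proof.
rewrite !big_ord_recr big_ord0 /= Monoid.mul1m.
by do ![congr (op _ _)]; congr F; exact/val_inj.
Qed.

Lemma eq_rev_ord n (i j : 'I_n) : (i == rev_ord j) = (j == rev_ord i).
Proof. by rewrite eq_sym (can2_eq rev_ordK rev_ordK). Qed.

Section ExplicitMatrices.
Context {T : comPzRingType}.

Definition mx4 (rows : seq (seq T)) : 'M[T]_4 :=
  \matrix_(i, j) nth 0 (nth [::] rows i) j.

Lemma J1_mul n (A : 'M[T]_(4, n)) i j : (J1 *m A) i j = A (rev_ord i) j.
Proof.
rewrite mxE (bigD1 (rev_ord i)) //= mxE eqxx mul1r big1 ?addr0 // => k ki.
by rewrite mxE (negbTE ki) mul0r.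
Qed.

Lemma mul_J1 n (A : 'M[T]_(n, 4)) i j : (A *m J1) i j = A i (rev_ord j).
Proof.
rewrite mxE (bigD1 (rev_ord j)) //= mxE rev_ordK eqxx mulr1 big1 ?addr0 // => k ki.
by rewrite mxE eq_rev_ord (negbTE ki) mulr0.
Qed.

Lemma J1_K : J1 *m J1 = 1%:M :> 'M[T]_4.
Proof. by apply/matrixP => i j; rewrite J1_mul !mxE rev_ordK eq_sym. Qed.

Lemma J1_tr : J1^T = J1 :> 'M[T]_4.
Proof. by apply/matrixP => i j; rewrite !mxE eq_rev_ord. Qed.

End ExplicitMatrices.

Section RealJ1.
Context {R : realType}.

Lemma signature22_congr (P S : 'M[R]_4) :
  S \in unitmx -> signature22 P -> signature22 (S *m P *m S^T).
Proof.
move=> uS [Q [uQ ->]]; exists (S *m Q); split; first by rewrite unitmx_mul uS.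
by rewrite trmx_mul !mulmxA.
Qed.

(* Polarization: [e0 e3^T + e3 e0^T = v v^T - w w^T] for [v = e0 + e3 / 2] and
   [w = e0 - e3 / 2], and likewise for [e1], [e2]. *)
Lemma signature22_J1 : signature22 (J1 : 'M[R]_4).
Proof.
pose S : 'M[R]_4 := mx4 [:: [:: 1; 0; 1; 0]; [:: 0; 1; 0; 1];
  [:: 0; 2^-1; 0; - 2^-1]; [:: 2^-1; 0; - 2^-1; 0]].
have E : J1 = S *m diag_mx (\row_j [:: 1; 1; -1; -1]`_j) *m S^T.
  apply/matrixP; apply: ord4P; apply: ord4P;
  rewrite mul_mx_diag !mxE big_ord4 !mxE /=; lra.
exists S; split=> //; have : J1 \in @unitmx R 4.
  by case/mulmx1_unit : (@J1_K R).
by rewrite {1}E !unitmx_mul => /andP[/andP[]].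
Qed.

Lemma det_J1 : \det (J1 : 'M[R]_4) = 1.
Proof.
have [S [_ E]] := signature22_J1.
have J_ge0 : 0 <= \det (J1 : 'M[R]_4).
  rewrite E !det_mulmx det_tr det_diag big_ord4 !mxE /=.
  by rewrite [leRHS](_ : _ = \det S ^+ 2) ?sqr_ge0 //; ring.
have : \det (J1 : 'M[R]_4) ^+ 2 = 1 by rewrite expr2 -det_mulmx J1_K det1.
by move/eqP; rewrite sqrp_eq1 // => /eqP.
Qed.

End RealJ1.

Section SixSymmetricSpace.
Context {R : realType}.
Local Notation C := R[i].
Local Notation MC := 'M[C]_4.
Local Notation eps := (@eps R).
Local Notation E := (@E R).
Implicit Types X : MC.

Lemma Complex_cos_sinD (x y : R) :
  Complex (cos x) (sin x) * Complex (cos y) (sin y) =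
  Complex (cos (x + y)) (sin (x + y)).
Proof. by rewrite cosD sinD; congr Complex; rewrite addrC. Qed.

Lemma eps3 : eps ^+ 3 = 1.
Proof.
rewrite exprS expr2 /Defs.eps !Complex_cos_sinD.
rewrite (_ : _ + _ = pi *+ 2); last by rewrite mulr2n; lra.
by rewrite cos2pi sin2pi.
Qed.

Lemma eps_neq1 : eps != 1.
Proof.
apply/eqP => -[_]; apply/eqP; rewrite gt_eqF //; apply: sin_gt0_pi.
by have := pi_gt0 R => pi0; apply/andP; split; lra.
Qed.

Lemma eps_neq0 : eps != 0.
Proof. by apply/eqP => e0; have := eps3; rewrite e0 expr0n /= => /eqP; rewrite eq_sym oner_eq0. Qed.

Lemma eps2_neq1 : eps ^+ 2 != 1.
Proof.
apply/eqP => e2; have := eps3; rewrite exprS e2 mulr1 => e1.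
by have := eps_neq1; rewrite e1 eqxx.
Qed.

Lemma eps2_neq : eps ^+ 2 != eps.
Proof.
rewrite expr2 -{3}[eps]mulr1 (inj_eq (mulfI eps_neq0)); exact: eps_neq1.
Qed.

Lemma epsV : eps^-1 = eps ^+ 2.
Proof. by apply: (mulfI eps_neq0); rewrite mulfV ?eps_neq0 // -exprS eps3. Qed.

Definition Ed : 'rV[C]_4 := \row_j [:: 1; eps ^+ 2; eps; 1]`_j.
Definition Ed' : 'rV[C]_4 := \row_j [:: 1; eps; eps ^+ 2; 1]`_j.

Lemma E_Ed : E = diag_mx Ed.
Proof. by []. Qed.

Lemma Ed_Ed' j : Ed 0 j * Ed' 0 j = 1.
Proof.
move: j; apply: ord4P; rewrite !mxE /= ?mulr1 // -?exprS -?exprSr; exact: eps3.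
Qed.

Lemma E_mulV : E *m diag_mx Ed' = 1%:M.
Proof.
rewrite E_Ed mulmx_diag; apply/matrixP => i j; rewrite !mxE.
by have := Ed_Ed' i; rewrite !mxE => ->.
Qed.

Lemma E_unit : E \in unitmx.
Proof. by have [] := mulmx1_unit E_mulV. Qed.

Lemma E_inv : invmx E = diag_mx Ed'.
Proof. by rewrite -[LHS]mulmx1 -E_mulV mulKmx // E_unit. Qed.

Lemma sigmaE X i j : sigma X i j = Ed 0 i * X i j * Ed' 0 j.
Proof. by rewrite /sigma E_inv mul_mx_diag mxE E_Ed mul_diag_mx mxE. Qed.

Lemma dkappaE X i j : dkappa X i j =
  - (Ed 0 (rev_ord j) * X (rev_ord j) (rev_ord i) * Ed' 0 (rev_ord i)).
Proof. by rewrite /dkappa mxE mul_J1 J1_mul mxE -sigmaE. Qed.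

Lemma det_sigma X : \det (sigma X) = \det X.
Proof.
rewrite /sigma !det_mulmx mulrAC -det_mulmx mulmxV ?E_unit //.
by rewrite det1 mul1r.
Qed.

Lemma kappa_fix X : \det X = 1 ->
  kappa X = X <-> X *m J1 *m (sigma X)^T = J1.
Proof.
move=> X1; have uY : (sigma X)^T \in unitmx.
  by rewrite unitmx_tr unitmxE det_sigma X1 unitr1.
rewrite /kappa /tau1; split=> [{1}<-|XJY].
  by rewrite -[_ *m J1 *m J1]mulmxA J1_K mulmx1 mulmxKV.
by rewrite -{1}XJY mulmxK // -mulmxA J1_K mulmx1.
Qed.

Lemma K_formE X i j : (X *m J1 *m (sigma X)^T) i j =
  \sum_l X i (rev_ord l) * (Ed 0 j * X j l * Ed' 0 l).
Proof. by rewrite mxE; apply: eq_bigr => l _; rewrite mul_J1 mxE sigmaE. Qed.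

(* With [G = J1 E^-1], [kappa X = X] says [X G X^T = G]. Transposing,
   [X G^T X^T = G^T], so [X] commutes with [G^T G^-1 = E^-1 J1 E J1 = E^-2]. *)
Lemma kappa_fix_commute X : \det X = 1 -> kappa X = X ->
  forall i j, X i j * Ed' 0 j ^+ 2 = Ed' 0 i ^+ 2 * X i j.
Proof.
move=> X1 /(kappa_fix X1) XJY.
have uX : X \in unitmx by rewrite unitmxE X1 unitr1.
have [G GE] : {G : MC | G = J1 *m invmx E} by exists (J1 *m invmx E).
have [G' GE'] : {G' : MC | G' = E *m J1} by exists (E *m J1).
have GG' : G *m G' = 1%:M.
  by rewrite GE GE' mulmxA mulmxKV ?E_unit // J1_K.
have ET : E^T = E by rewrite E_Ed tr_diag_mx.
have XGX : X *m G *m X^T = G.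
  have := congr1 (fun A => A *m invmx E) XJY.
  by rewrite /sigma !trmx_mul trmx_inv ET !mulmxA mulmxK ?E_unit // -GE -[X *m J1 *m _]mulmxA -GE.
have XGtX : X *m G^T *m X^T = G^T by rewrite -{2}XGX !trmx_mul trmxK mulmxA.
have XT : X^T = G' *m invmx X *m G.
  have [uG uG'] := mulmx1_unit GG'.
  have GV : G' = invmx G by rewrite -[LHS]mul1mx -(mulVmx uG) -mulmxA GG' mulmx1.
  have : G' *m invmx X *m (X *m G *m X^T) = X^T.
    by rewrite GV -!mulmxA mulKmx // mulKmx.
  by rewrite XGX.
have H : X *m (G^T *m G') = G^T *m G' *m X.
  have := XGtX; rewrite XT !mulmxA => /(congr1 (fun A => A *m G' *m X)).
  by rewrite -[_ *m G *m G']mulmxA GG' mulmx1 mulmxKV.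
have GtG' : G^T *m G' = diag_mx (\row_i Ed' 0 i ^+ 2).
  have Erev k : Ed 0 (rev_ord k) = Ed' 0 k.
    by move: k; apply: ord4P; rewrite rev_ord4 !mxE.
  rewrite GE GE' trmx_mul J1_tr trmx_inv ET E_inv !mulmxA.
  apply/matrixP => i j; rewrite mul_J1 E_Ed mul_mx_diag mxE mul_J1 rev_ordK Erev !mxE.
  by case: (i =P j) => [->|_]; rewrite ?mulr0n ?mul0r // !mulr1n expr2.
move=> i j; have /matrixP/(_ i j) := H.
by rewrite GtG' mul_mx_diag mul_diag_mx !mxE.
Qed.

Lemma sigma_diag (d : 'rV[C]_4) : sigma (diag_mx d) = diag_mx d.
Proof.
apply/matrixP => i j; rewrite sigmaE [diag_mx d i j]mxE.
by case: eqP => [->|_]; rewrite ?mulr0n ?mulr0 ?mul0r // mulr1n mulrAC Ed_Ed' mul1r.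
Qed.

Definition Kdiag (k1 k2 : C) : MC := diag_mx (\row_j [:: k1; k2; k2^-1; k1^-1]`_j).

Lemma Kdiag_K k1 k2 : k1 != 0 -> k2 != 0 -> K (Kdiag k1 k2).
Proof.
move=> k10 k20; have d1 : \det (Kdiag k1 k2) = 1.
  by rewrite det_diag big_ord4 !mxE /=; field; rewrite k10 k20.
split=> //; apply/kappa_fix => //.
rewrite sigma_diag; apply/matrixP => i j; rewrite mxE big_ord4 !mul_J1 !rev_ord4 !mxE.
by move: i j; apply: ord4P; apply: ord4P;
  rewrite /= !(mulr0n, mulr1n, mul0r, mulr0, addr0, add0r) ?mulfV ?mulVf.
Qed.

Lemma K_offdiag X i j : K X -> Ed' 0 i ^+ 2 != Ed' 0 j ^+ 2 -> X i j = 0.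
Proof.
move=> [X1 fX] nij; have := kappa_fix_commute X1 fX i j.
rewrite mulrC => /eqP; rewrite -subr_eq0 -mulrBl mulf_eq0 subr_eq0 eq_sym.
by rewrite (negbTE nij) => /eqP.
Qed.

Lemma det_antidiag_block X :
  (forall i j, j != tperm o0 o3 i -> X i j = 0) ->
  \det X = - (X o0 o3 * X o1 o1 * X o2 o2 * X o3 o0).
Proof.
move=> X0; have XE : X = diag_mx (\row_i X i (tperm o0 o3 i)) *m perm_mx (tperm o0 o3).
  apply/matrixP => i j; rewrite mul_diag_mx !mxE eq_sym.
  by case: eqP => [<-|/eqP /X0 ->]; rewrite ?mulr1 ?mulr0.
rewrite {1}XE det_mulmx det_diag det_perm odd_tperm /= expr1 mulrN1 big_ord4.
by rewrite !mxE !permE.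
Qed.

Lemma KE : K = [set Kdiag k1 k2
  | k1 in [set k : C | k != 0] & k2 in [set k : C | k != 0]].
Proof.
apply/seteqP; split=> [X KX|_ [k1 /= k10 [k2 /= k20 <-]]]; last exact: Kdiag_K.
have [X1 fX] := KX; have e4 : (eps ^+ 2) ^+ 2 = eps.
  by rewrite -exprM exprSr eps3 mul1r.
have off i j (nij : [&& i != j & (i, j) \notin [:: (o0, o3); (o3, o0)]]) : X i j = 0.
  apply: K_offdiag => //; rewrite !mxE; move: i j nij.
  by apply: ord4P; apply: ord4P => //= _; rewrite ?expr1n ?e4 // ?eps2_neq ?eps2_neq1
    ?eps_neq1 // eq_sym ?eps2_neq ?eps2_neq1 ?eps_neq1.
have /matrixP XJ := (kappa_fix X1).1 fX.
have := XJ o0 o0; have := XJ o0 o3; have := XJ o3 o3; have := XJ o1 o2.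
rewrite !K_formE !big_ord4 !rev_ord4 !mxE /=.
rewrite !(off o0 o1, off o0 o2, off o1 o0, off o1 o2, off o1 o3, off o2 o0,
  off o2 o1, off o2 o3, off o3 o1, off o3 o2) //.
rewrite !(mul0r, mulr0, addr0, add0r, mulr1, mul1r) => e12 e33 e03 e00.
have {}e12 : X o1 o1 * X o2 o2 = 1.
  rewrite -[RHS]e12 [eps * _]mulrC -!mulrA -exprS eps3 mulr1; done.
have X00 : X o0 o0 != 0.
  apply/eqP => X00; move: e03; rewrite X00 mul0r addr0 => e03.
  have X30 : X o3 o0 != 0.
    by apply/eqP => X30; move: e03; rewrite X30 mulr0 => /eqP; rewrite eq_sym oner_eq0.
  have X33 : X o3 o3 = 0.
    move: e33; rewrite [X o3 o0 * _]mulrC -mulr2n => /eqP.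
    by rewrite mulrn_eq0 mulf_eq0 (negbTE X30) orbF => /eqP.
  have : \det X = -1.
    rewrite det_antidiag_block; last first.
      by apply: ord4P; apply: ord4P; rewrite permE //= => _; exact: off.
    by rewrite -[X o0 o3 * _ * _]mulrA e12 mulr1 e03.
  by rewrite X1 => /eqP; rewrite -subr_eq0 opprK paddr_eq0 ?oner_eq0 ?ler01.
have X03 : X o0 o3 = 0.
  move: e00; rewrite [X o0 o0 * _]mulrC -mulr2n => /eqP.
  by rewrite mulrn_eq0 mulf_eq0 (negbTE X00) orbF => /eqP.
move: e03; rewrite X03 mul0r add0r => e03.
have X33 : X o3 o3 != 0.
  by apply/eqP => X33; move: e03; rewrite X33 mulr0 => /eqP; rewrite eq_sym oner_eq0.
have X30 : X o3 o0 = 0.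
  move: e33; rewrite [X o3 o0 * _]mulrC -mulr2n => /eqP.
  by rewrite mulrn_eq0 mulf_eq0 (negbTE X33) => /eqP.
have X11 : X o1 o1 != 0.
  by apply/eqP => X11; move: e12; rewrite X11 mul0r => /eqP; rewrite eq_sym oner_eq0.
exists (X o0 o0) => //; exists (X o1 o1) => //.
have X33V : X o3 o3 = (X o0 o0)^-1 by apply: (mulfI X00); rewrite e03 mulfV.
have X22V : X o2 o2 = (X o1 o1)^-1 by apply: (mulfI X11); rewrite e12 mulfV.
apply/matrixP; apply: ord4P; apply: ord4P; rewrite !mxE /= ?mulr0n ?mulr1n //;
  by rewrite ?off.
Qed.

End SixSymmetricSpace.
Definition frame_U {R : realType} (a b l : R) : 'M[R]_4 :=
  mx4 [:: [:: a; 0; l; 0]; [:: 1; - a; 0; l]; [:: 0; b; a; 0]; [:: 0; 0; 1; - a]].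

Definition frame_V {R : realType} (e c k : R) : 'M[R]_4 :=
  mx4 [:: [:: e; k; 0; 0]; [:: 0; e; c; 0]; [:: 1; 0; - e; k]; [:: 0; 1; 0; - e]].

Section PrimitiveFrames.
Context {R : realType}.
Local Notation eps := (@eps R).
Local Notation rc := (real_complex R).

Lemma eigenspace_g0_diag (d : 'rV[R[i]]_4) :
  (forall j, d 0 (rev_ord j) = - d 0 j) -> eigenspace_g 0 (diag_mx d).
Proof.
move=> dN; split.
  have := dN o0; have := dN o1; rewrite !rev_ord4 mxtrace_diag big_ord4 => -> ->.
  by rewrite /= addrK subrr.
rewrite expr0z scale1r; apply/matrixP => i j.
rewrite dkappaE -sigmaE sigma_diag !mxE (inj_eq rev_ord_inj) eq_sym.
by case: eqP => [->|_]; rewrite ?mulr0n ?oppr0 // !mulr1n dN opprK.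
Qed.

Lemma frame_U_primitive (a b l : R) :
  addset (eigenspace_g 0) (eigenspace_g (-1)) (toC_mx (frame_U a b l)).
Proof.
exists (diag_mx (\row_j [:: rc a; - rc a; rc a; - rc a]`_j)).
  by apply: eigenspace_g0_diag; apply: ord4P; rewrite !mxE /= ?opprK.
exists (mx4 [:: [:: 0; 0; rc l; 0]; [:: 1; 0; 0; rc l]; [:: 0; rc b; 0; 0]; [:: 0; 0; 1; 0]]).
  split; first by rewrite /mxtrace big_ord4 !mxE /= !addr0.
  rewrite exprN1 invrN epsV; apply/matrixP; apply: ord4P; apply: ord4P;
    rewrite dkappaE !rev_ord4 !mxE /=; ring.
apply/matrixP; apply: ord4P; apply: ord4P;
  by rewrite !mxE /= ?mulr0n ?mulr1n ?add0r ?addr0 ?raddf0 ?raddfN ?rmorph1.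
Qed.

Lemma frame_V_primitive (e c k : R) :
  addset (eigenspace_g 0) (eigenspace_g 1) (toC_mx (frame_V e c k)).
Proof.
exists (diag_mx (\row_j [:: rc e; rc e; - rc e; - rc e]`_j)).
  by apply: eigenspace_g0_diag; apply: ord4P; rewrite !mxE /= ?opprK.
exists (mx4 [:: [:: 0; rc k; 0; 0]; [:: 0; 0; rc c; 0]; [:: 1; 0; 0; rc k]; [:: 0; 1; 0; 0]]).
  split; first by rewrite /mxtrace big_ord4 !mxE /= !addr0.
  have e4 x : eps ^+ 2 * x * eps ^+ 2 = eps * x.
    by rewrite mulrAC -exprD exprS eps3 mulr1.
  rewrite expr1z; apply/matrixP; apply: ord4P; apply: ord4P;
    rewrite dkappaE !rev_ord4 !mxE /= ?e4; ring.
apply/matrixP; apply: ord4P; apply: ord4P;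
  by rewrite !mxE /= ?mulr0n ?mulr1n ?add0r ?addr0 ?raddf0 ?raddfN ?rmorph1.
Qed.

Lemma toC_mxM m n p (A : 'M[R]_(m, n)) (B : 'M[R]_(n, p)) :
  toC_mx (A *m B) = toC_mx A *m toC_mx B.
Proof. exact: (map_mxM rc). Qed.

Lemma det_toC_mx n (A : 'M[R]_n) : \det (toC_mx A) = rc (\det A).
Proof. exact: (det_map_mx rc). Qed.

Lemma toC_J1 : toC_mx (J1 : 'M[R]_4) = J1.
Proof. by apply/matrixP => i j; rewrite !mxE; case: eqP => _; rewrite ?rmorph0 ?rmorph1. Qed.

Lemma toC_mx_K1C (X : 'M[R]_4) : \det X = 1 -> X *m J1 *m X^T = J1 ->
  K1C (toC_mx X).
Proof.
move=> X1 XJX; split; first by rewrite /SL4C /= det_toC_mx X1.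
have -> : (toC_mx X)^T = toC_mx X^T by rewrite /toC_mx map_trmx.
by rewrite -toC_J1 -!toC_mxM XJX.
Qed.

Lemma K1C_mul (X Y : 'M[R[i]]_4) : K1C X -> K1C Y -> K1C (X *m Y).
Proof.
move=> [X1 XJ] [Y1 YJ]; split; first by rewrite /SL4C /= det_mulmx X1 Y1 mulr1.
by rewrite trmx_mul mulmxA -(mulmxA X) -(mulmxA X) YJ.
Qed.

Lemma K_sub_K1C : K `<=` @K1C R.
Proof.
move=> X KX; have [X1 fX] := KX; split=> //.
move: KX; rewrite KE => -[k1 _ [k2 _ XE]].
by have := (kappa_fix X1).1 fX; rewrite -XE sigma_diag.
Qed.

Lemma proj_frame_coset (F : 'M[R]_4) : \det F = 1 ->
  proj_K_K1C (mulset [set toC_mx F] K) = quadric_to_K1C (F *m J1 *m F^T).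
Proof.
move=> F1; have uF : F \in unitmx by rewrite unitmxE F1 unitr1.
apply/seteqP; split=> [_ [_ [_ -> [k Kk <-]] [h Kh <-]]|].
  exists (toC_mx F); first by exists F.
  by exists (k *m h); [exact: K1C_mul (K_sub_K1C Kk) Kh|rewrite mulmxA].
move=> _ [_ [X [X1 XJ] <-] [h Kh <-]].
have K1 : K (1%:M : 'M[R[i]]_4).
  rewrite KE; exists 1; first exact: oner_neq0.
  exists 1; first exact: oner_neq0.
  apply/matrixP; apply: ord4P; apply: ord4P; rewrite !mxE /= ?mulr0n ?mulr1n ?invr1 //.
exists (toC_mx F *m 1%:M); first by exists (toC_mx F) => //; exists 1%:M.
exists (toC_mx (invmx F *m X) *m h).
  apply: K1C_mul => //; apply: toC_mx_K1C.
    by rewrite det_mulmx det_inv F1 invr1 mul1r.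
  by rewrite trmx_mul -!mulmxA (mulmxA J1) (mulmxA X) (mulmxA X) XJ -!mulmxA
    -trmx_mul mulVmx // trmx1 mulmx1 mulKmx.
by rewrite mulmx1 mulmxA -toC_mxM mulKVmx.
Qed.

End PrimitiveFrames.

(** * The first-order Gauss map *)

Section GaussMapAlgebra.
Context {R : realType}.
Implicit Types F A B : 'M[R]_4.

Definition gauss_U (b l : R) : 'M[R]_4 :=
  mx4 [:: [:: 0; l; 0; 0]; [:: l; 0; 0; 1]; [:: 0; 0; b; 0]; [:: 0; 1; 0; 0]].

Definition gauss_V (c k m : R) : 'M[R]_4 :=
  mx4 [:: [:: 0; 0; k; 0]; [:: 0; c; 0; 0]; [:: k; 0; 0; m]; [:: 0; 0; m; 0]].

Lemma frame_U_J1 (a b l : R) :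
  frame_U a b l *m J1 + J1 *m (frame_U a b l)^T = 2 *: gauss_U b l.
Proof.
apply/matrixP; apply: ord4P; apply: ord4P;
  rewrite [LHS]mxE mul_J1 J1_mul !rev_ord4 !mxE /=; ring.
Qed.

Lemma frame_V_J1 (e c k : R) :
  frame_V e c k *m J1 + J1 *m (frame_V e c k)^T = 2 *: gauss_V c k 1.
Proof.
apply/matrixP; apply: ord4P; apply: ord4P;
  rewrite [LHS]mxE mul_J1 J1_mul !rev_ord4 !mxE /=; ring.
Qed.

Lemma invmx_gauss F : \det F = 1 ->
  invmx (F *m J1 *m F^T) = invmx F^T *m J1 *m invmx F.
Proof.
move=> F1; have uF : F \in unitmx by rewrite unitmxE F1 unitr1.
have uT : F^T \in unitmx by rewrite unitmx_tr.
have H : F *m J1 *m F^T *m (invmx F^T *m J1 *m invmx F) = 1%:M.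
  by rewrite !mulmxA mulmxK // -(mulmxA F) J1_K mulmx1 mulmxV.
have [uP _] := mulmx1_unit H.
by rewrite -[LHS]mulmx1 -H mulKmx.
Qed.

Lemma gauss_conj_mul F A B : \det F = 1 ->
  F *m A *m F^T *m invmx (F *m J1 *m F^T) *m (F *m B *m F^T) =
  F *m (A *m J1 *m B) *m F^T.
Proof.
move=> F1; have uF : F \in unitmx by rewrite unitmxE F1 unitr1.
have uT : F^T \in unitmx by rewrite unitmx_tr.
by rewrite invmx_gauss // !mulmxA mulmxK // mulmxKV.
Qed.

Lemma gauss_metric F A : \det F = 1 ->
  metric (F *m J1 *m F^T) (F *m A *m F^T) (F *m A *m F^T) =
  \tr (J1 *m A *m J1 *m A).
Proof.
move=> F1; have uF : F \in unitmx by rewrite unitmxE F1 unitr1.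
have assoc (P X : 'M[R]_4) : P *m X *m P *m X = P *m (X *m P *m X).
  by rewrite !mulmxA.
rewrite /metric assoc gauss_conj_mul // invmx_gauss // -!mulmxA mulKmx //.
by rewrite mxtrace_mulC -!mulmxA mulmxV ?mulmx1 ?mulmxA // unitmx_tr.
Qed.

Lemma gauss_U_isotropic (b l : R) :
  \tr (J1 *m (2 *: gauss_U b l) *m J1 *m (2 *: gauss_U b l)) = 0.
Proof.
rewrite /mxtrace big_ord4 !mxE !big_ord4 !mul_J1 !J1_mul !rev_ord4 !mxE /=; ring.
Qed.

Lemma gauss_V_isotropic (c k : R) :
  \tr (J1 *m (2 *: gauss_V c k 1) *m J1 *m (2 *: gauss_V c k 1)) = 0.
Proof.
rewrite /mxtrace big_ord4 !mxE !big_ord4 !mul_J1 !J1_mul !rev_ord4 !mxE /=; ring.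
Qed.

(* [frame_U a b l] is [diag(a, -a, a, -a) + gauss_U b l *m J1]; the second
   summand is cancelled by the connection term. *)
Lemma gauss_harmonic_identity (a b c k l : R) :
  frame_U a b l *m gauss_V c k 1 + gauss_V c k 1 *m (frame_U a b l)^T
  + gauss_V (2 * a * c) (- (2 * a * k)) 0
  = gauss_U b l *m J1 *m gauss_V c k 1 + gauss_V c k 1 *m J1 *m gauss_U b l.
Proof.
apply/matrixP; apply: ord4P; apply: ord4P;
  rewrite !mxE !big_ord4 !mul_J1 !rev_ord4 !mxE /=; ring.
Qed.

End GaussMapAlgebra.

Section DemoulinFrame.
Context {R : realType} (D : set (R * R)).
Variables (b c p q : R * R -> R) (f : R * R -> 'cV[R]_4).
Hypotheses (oD : open D) (sb : smooth D b) (sc : smooth D c) (sf : smooth D f).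
Hypothesis f_system : forall u, D u -> canonical_system b c p q f u.
Hypothesis bc0 : forall u, D u -> b u * c u != 0.
Hypothesis PQ0 : forall u, D u -> invP b c p u = 0 /\ invQ b c q u = 0.
Hypothesis F1 : forall u, D u -> \det (wilczynski_frame b c f u) = 1.

Local Notation F := (wilczynski_frame b c f).
Local Notation al := (frame_al c).
Local Notation be := (frame_be b).
Local Notation k := (frame_k b c).
Local Notation l := (frame_l b c).
Local Notation fi i := (fun u => f u i 0).
Local Notation e1 := ((1, 0) : R * R).
Local Notation e2 := ((0, 1) : R * R).

Lemma smooth_coord {m n} (M : R * R -> 'M[R]_(m, n)) i j :
  smooth D M -> smooth D (fun u => M u i j).
Proof. by move=> /smooth_mxP; apply. Qed.

Lemma dx_coord {m n} (M : R * R -> 'M[R]_(m, n)) i j u : smooth D M -> D u ->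
  dx M u i j = dx (fun v => M v i j) u.
Proof. by move=> sM Du; have [DM _] := smooth_is_dx sM Du; rewrite /dx derive_mxE. Qed.

Lemma dy_coord {m n} (M : R * R -> 'M[R]_(m, n)) i j u : smooth D M -> D u ->
  dy M u i j = dy (fun v => M v i j) u.
Proof. by move=> sM Du; have [DM _] := smooth_is_dy sM Du; rewrite /dy derive_mxE. Qed.

Lemma eq_in_dx (g h : R * R -> R) u : D u -> {in D, g =1 h} -> dx g u = dx h u.
Proof. by move=> Du gh; exact: near_eq_derive (nbhs_open_eq oD Du gh). Qed.

Lemma eq_in_dy (g h : R * R -> R) u : D u -> {in D, g =1 h} -> dy g u = dy h u.
Proof. by move=> Du gh; exact: near_eq_derive (nbhs_open_eq oD Du gh). Qed.

Let sfi i : smooth D (fi i).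
Proof. exact: smooth_coord. Qed.

Lemma coord_xx i u : D u -> dx (dx (fi i)) u = b u * dy (fi i) u + p u * f u i 0.
Proof.
move=> Du; have [/matrixP/(_ i 0) + _] := f_system Du.
rewrite !mxE (dx_coord _ _ (smooth_dx sf)) // (dy_coord _ _ sf) // => <-.
by apply: eq_in_dx => // v /set_mem Dv; rewrite (dx_coord _ _ sf).
Qed.

Lemma coord_yy i u : D u -> dy (dy (fi i)) u = c u * dx (fi i) u + q u * f u i 0.
Proof.
move=> Du; have [_ /matrixP/(_ i 0)] := f_system Du.
rewrite !mxE (dy_coord _ _ (smooth_dy sf)) // (dx_coord _ _ sf) // => <-.
by apply: eq_in_dy => // v /set_mem Dv; rewrite (dy_coord _ _ sf).
Qed.

Lemma frameE u : D u -> forall i,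
  [/\ F u i o0 = f u i 0, F u i o1 = sol1 c (fi i) u,
      F u i o2 = sol2 b (fi i) u & F u i o3 = sol_eta b c (fi i) u].
Proof.
move=> Du i.
have comb2 (X Y : 'cV[R]_4) s : (X - s *: Y) i 0 = X i 0 - s * Y i 0.
  by rewrite !mxE.
have comb4 (X Y Z W : 'cV[R]_4) s t r :
    (X - s *: Y - t *: Z + r *: W) i 0 = X i 0 - s * Y i 0 - t * Z i 0 + r * W i 0.
  by rewrite !mxE.
have Ex := dx_coord i 0 sf Du; have Ey := dy_coord i 0 sf Du.
have Exy : dy (dx f) u i 0 = dy (dx (fi i)) u.
  apply: etrans (dy_coord i 0 (smooth_dx sf) Du) _.
  by apply: eq_in_dy => // v /set_mem Dv; exact: dx_coord sf Dv.
split.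
- by rewrite mxE.
- by apply: etrans (mxE _ _ _ _) _; apply: etrans (comb2 _ _ _) _; rewrite Ex.
- by apply: etrans (mxE _ _ _ _) _; apply: etrans (comb2 _ _ _) _; rewrite Ey.
- by apply: etrans (mxE _ _ _ _) _; apply: etrans (comb4 _ _ _ _ _ _ _) _; rewrite Ex Ey Exy.
Qed.

Lemma smooth_frame : smooth D F.
Proof.
apply/smooth_mxP => // i; apply: ord4P.
- by apply: smooth_eq (sfi i) => // u /set_mem Du; have [-> _ _ _] := frameE Du i.
- apply: smooth_eq (smooth_sol1 oD sc bc0 (sfi i)) => // u /set_mem Du.
  by have [_ -> _ _] := frameE Du i.
- apply: smooth_eq (smooth_sol2 oD sb bc0 (sfi i)) => // u /set_mem Du.
  by have [_ _ -> _] := frameE Du i.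
- apply: smooth_eq (smooth_sol_eta oD sb sc bc0 (sfi i)) => // u /set_mem Du.
  by have [_ _ _ ->] := frameE Du i.
Qed.

Lemma frame_AB0 u : D u -> frame_A b c u = 0 /\ frame_B b c u = 0.
Proof.
move=> Du; have uF : F u \in unitmx by rewrite unitmxE F1 // unitr1.
pose A := frame_A b c; pose B := frame_B b c.
pose w : 'cV[R]_4 := \col_i [:: dx B u - dy A u + 2 * al u * B u - 2 * be u * A u;
  2 * B u; - (2 * A u); 0]`_i.
have Fw : F u *m w = 0.
  apply/matrixP => i j; rewrite (ord1 j) mxE big_ord4.
  have [-> -> -> _] := frameE Du i.
  rewrite [RHS]mxE [w o0 0]mxE [w o1 0]mxE [w o2 0]mxE [w o3 0]mxE /= mulr0 addr0.
  have := sol_compatibility oD sb sc bc0 PQ0 (sfi i) (coord_xx i) (coord_yy i) Du.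
  rewrite -/A -/B => <-.
  by rewrite mulrN; congr (_ + _ - _); rewrite mulrC.
have /matrixP w0 : w = 0 by rewrite -[w](mulKmx uF) Fw mulmx0.
have := w0 o1 0; have := w0 o2 0; rewrite !mxE /= -/A -/B => /eqP + /eqP.
by rewrite oppr_eq0 !mulf_eq0 pnatr_eq0 /= => /eqP + /eqP.
Qed.

Lemma is_dx_frame u : D u ->
  is_derive u e1 F (F u *m frame_U (al u) (b u) (l u)).
Proof.
move=> Du; have [A0 _] := frame_AB0 Du; apply/is_derive_mxP => i j.
have D0 := smooth_is_dx (smooth_coord i j smooth_frame) Du.
have /is_derive_eq := D0; apply; rewrite mxE big_ord4.
have [E0 E1 E2 E3] := frameE Du i; rewrite {}E0 {}E1 {}E2 {}E3.
have eqF j' g : (forall v, D v -> F v i j' = g v) -> dx (fun v => F v i j') u = dx g u.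
  by move=> Eg; apply: eq_in_dx => // v /set_mem; exact: Eg.
move: j D0 => + _; apply: ord4P; rewrite !mxE /=.
- rewrite (eqF _ (fi i)); last by move=> v Dv; have [] := frameE Dv i.
  rewrite (dx_sol c); ring.
- rewrite (eqF _ (sol1 c (fi i))); last by move=> v Dv; have [] := frameE Dv i.
  rewrite (dx_sol1 oD sc bc0 PQ0 (sfi i) (coord_xx i)) //; ring.
- rewrite (eqF _ (sol2 b (fi i))); last by move=> v Dv; have [] := frameE Dv i.
  rewrite (dx_sol2 oD sb bc0 (sfi i)) //; ring.
- rewrite (eqF _ (sol_eta b c (fi i))); last by move=> v Dv; have [] := frameE Dv i.
  rewrite (dx_sol_eta oD sb sc bc0 PQ0 (sfi i) (coord_xx i) (coord_yy i)) // A0; ring.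
Qed.

Lemma is_dy_frame u : D u ->
  is_derive u e2 F (F u *m frame_V (be u) (c u) (k u)).
Proof.
move=> Du; have [_ B0] := frame_AB0 Du; apply/is_derive_mxP => i j.
have D0 := smooth_is_dy (smooth_coord i j smooth_frame) Du.
have /is_derive_eq := D0; apply; rewrite mxE big_ord4.
have [E0 E1 E2 E3] := frameE Du i; rewrite {}E0 {}E1 {}E2 {}E3.
have eqF j' g : (forall v, D v -> F v i j' = g v) -> dy (fun v => F v i j') u = dy g u.
  by move=> Eg; apply: eq_in_dy => // v /set_mem; exact: Eg.
move: j D0 => + _; apply: ord4P; rewrite !mxE /=.
- rewrite (eqF _ (fi i)); last by move=> v Dv; have [] := frameE Dv i.
  rewrite (dy_sol b); ring.
- rewrite (eqF _ (sol1 c (fi i))); last by move=> v Dv; have [] := frameE Dv i.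
  rewrite (dy_sol1 oD sc bc0 (sfi i)) //; ring.
- rewrite (eqF _ (sol2 b (fi i))); last by move=> v Dv; have [] := frameE Dv i.
  rewrite (dy_sol2 oD sb bc0 PQ0 (sfi i) (coord_yy i)) //; ring.
- rewrite (eqF _ (sol_eta b c (fi i))); last by move=> v Dv; have [] := frameE Dv i.
  rewrite (dy_sol_eta oD sb sc bc0 PQ0 (sfi i) (coord_xx i) (coord_yy i)) // B0; ring.
Qed.

Local Notation g1 := (first_order_gauss_map F).

Lemma is_derive_gauss u e (U W : 'M[R]_4) :
  is_derive u e F (F u *m U) -> U *m J1 + J1 *m U^T = 2 *: W ->
  is_derive u e g1 (F u *m (2 *: W) *m (F u)^T).
Proof.
move=> DF <-; have DFJ := is_derive_mulmx DF (is_derive_cst (J1 : 'M[R]_4) u e).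
have /is_derive_eq := is_derive_mulmx DFJ (is_derive_trmx DF); apply.
by rewrite mulmx0 addr0 trmx_mul mulmxDr mulmxDl !mulmxA.
Qed.

Lemma dx_gauss u : D u ->
  dx g1 u = F u *m (2 *: gauss_U (b u) (l u)) *m (F u)^T.
Proof.
by move=> Du; have [] := is_derive_gauss (is_dx_frame Du) (frame_U_J1 _ _ _).
Qed.

Lemma dy_gauss u : D u ->
  dy g1 u = F u *m (2 *: gauss_V (c u) (k u) 1) *m (F u)^T.
Proof.
by move=> Du; have [] := is_derive_gauss (is_dy_frame Du) (frame_V_J1 _ _ _).
Qed.

Lemma quadrics_gauss u : D u -> quadrics (g1 u).
Proof.
move=> Du; rewrite /first_order_gauss_map; split.
- by rewrite !trmx_mul trmxK J1_tr mulmxA.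
- by rewrite !det_mulmx det_tr F1 // det_J1 !mulr1.
- by apply: signature22_congr signature22_J1; rewrite unitmxE F1 // unitr1.
Qed.

Lemma conformal_gauss : conformal D g1.
Proof.
move=> u Du; rewrite dx_gauss // dy_gauss //.
split; apply: etrans (gauss_metric _ (F1 Du)) _.
  exact: gauss_U_isotropic.
exact: gauss_V_isotropic.
Qed.

Lemma dxdy_gauss u : D u -> dx (dy g1) u =
  F u *m (2 *: (gauss_U (b u) (l u) *m J1 *m gauss_V (c u) (k u) 1 +
                gauss_V (c u) (k u) 1 *m J1 *m gauss_U (b u) (l u))) *m (F u)^T.
Proof.
move=> Du; have DF := is_dx_frame Du; have [A0 _] := frame_AB0 Du.
have Dc : is_derive u e1 c (2 * al u * c u).
  have -> : 2 * al u * c u = dx c u.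
    rewrite /frame_al; move: (c u) (dx c u) (c_neq0 bc0 Du) => x y x0.
    by field.
  exact: smooth_is_dx sc Du.
have Dk : is_derive u e1 k (- (2 * al u * k u)).
  have -> : - (2 * al u * k u) = dx k u.
    by move: A0; rewrite /frame_A => /eqP; rewrite addr_eq0 => /eqP ->.
  exact: smooth_is_dx (smooth_k oD sb sc bc0) Du.
have D0 (x : R) : is_derive u e1 (fun=> x) 0 by exact: is_derive_cst.
have DW : is_derive u e1 (fun v => 2 *: gauss_V (c v) (k v) 1)
    (2 *: gauss_V (2 * al u * c u) (- (2 * al u * k u)) 0).
  apply/is_derive_mxP => i j.
  have -> : (fun v => (2 *: gauss_V (c v) (k v) 1) i j) =
            fun v => 2 * gauss_V (c v) (k v) 1 i j.
    by apply/funext => v; rewrite mxE.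
  have DG : is_derive u e1 (fun v => gauss_V (c v) (k v) 1 i j)
      (gauss_V (2 * al u * c u) (- (2 * al u * k u)) 0 i j).
    have mx4E (x y z : R) i' j' : gauss_V x y z i' j' = nth 0 (nth [::]
      [:: [:: 0; 0; y; 0]; [:: 0; x; 0; 0]; [:: y; 0; 0; z]; [:: 0; 0; z; 0]] i') j'.
      by rewrite mxE.
    rewrite mx4E (_ : (fun v => _) = fun v => nth 0 (nth [::]
      [:: [:: 0; 0; k v; 0]; [:: 0; c v; 0; 0]; [:: k v; 0; 0; 1]; [:: 0; 0; 1; 0]] i) j).
      by move: i j; apply: ord4P; apply: ord4P => /=.
    by apply/funext => v; rewrite mx4E.
  have /is_derive_eq := is_derive_mulf (D0 2) DG; apply.
  by rewrite mul0r add0r [RHS]mxE.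
have Dg := is_derive_mulmx (is_derive_mulmx DF DW) (is_derive_trmx DF).
have {Dg} [|_ E] := is_derive_eq_in oD Du _ Dg (k := dy g1).
  by move=> v /set_mem Dv; rewrite dy_gauss.
apply: etrans E _; rewrite -(gauss_harmonic_identity (al u)) trmx_mul.
move: (F u) (frame_U _ _ _) (gauss_V _ _ _) (gauss_V _ _ _) => G U W W'.
rewrite !(scalerDr, mulmxDr, mulmxDl, =^~ scalemxAr, =^~ scalemxAl) !mulmxA.
by rewrite addrAC.
Qed.

Lemma lorentz_harmonic_gauss : lorentz_harmonic D g1.
Proof.
exists quadrics_gamma; split; first exact: levi_civita_quadrics_gamma.
move=> u Du; rewrite dxdy_gauss // dx_gauss // dy_gauss // /quadrics_gamma.
have GE (A B : 'M[R]_4) := gauss_conj_mul A B (F1 Du).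
rewrite /first_order_gauss_map !GE.
move: (F u) (gauss_U _ _) (gauss_V _ _ _) => G A B.
rewrite !(=^~ scalemxAr, =^~ scalemxAl) -!scalerDr !scalerA mulrA mulNr mulVf ?pnatr_eq0 //.
by rewrite -mulmxDl -mulmxDr mulN1r scaleNr subrr.
Qed.

Lemma Re_toC_mx m n (A : 'M[R]_(m, n)) : Re_mx (toC_mx A) = A.
Proof. by apply/matrixP => i j; rewrite !mxE. Qed.

Lemma Im_toC_mx m n (A : 'M[R]_(m, n)) : Im_mx (toC_mx A) = 0.
Proof. by apply/matrixP => i j; rewrite !mxE. Qed.

Lemma complex_mx0 m n (A : 'M[R]_(m, n)) : complex_mx A 0 = toC_mx A.
Proof. by apply/matrixP => i j; rewrite !mxE. Qed.

Lemma frame_primitive :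
  lorentz_primitive D (fun u => mulset [set toC_mx (F u)] K).
Proof.
have ReE : (fun u => Re_mx (toC_mx (F u))) = F.
  by apply/funext => u; rewrite Re_toC_mx.
have ImE : (fun u => Im_mx (toC_mx (F u))) = fun=> 0.
  by apply/funext => u; rewrite Im_toC_mx.
exists (fun u => toC_mx (F u)); split.
  split; [rewrite ReE; exact: smooth_frame|rewrite ImE; exact: smooth_cst].
move=> u Du; have uF : toC_mx (F u) \in unitmx.
  by rewrite unitmxE det_toC_mx F1 // rmorph1 unitr1.
have d1 : SL4C (toC_mx (F u)) by rewrite /SL4C /= det_toC_mx F1 // rmorph1.
split=> //.
- have -> : dxC (fun u => toC_mx (F u)) u =
      toC_mx (F u) *m toC_mx (frame_U (al u) (b u) (l u)).
    rewrite /dxC ReE ImE -toC_mxM -complex_mx0; have [_ <-] := is_dx_frame Du.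
    by congr complex_mx; exact: derive_cst.
  by rewrite mulKmx //; exact: frame_U_primitive.
- have -> : dyC (fun u => toC_mx (F u)) u =
      toC_mx (F u) *m toC_mx (frame_V (be u) (c u) (k u)).
    rewrite /dyC ReE ImE -toC_mxM -complex_mx0; have [_ <-] := is_dy_frame Du.
    by congr complex_mx; exact: derive_cst.
  by rewrite mulKmx //; exact: frame_V_primitive.
Qed.

End DemoulinFrame.

Theorem theorem2p5 (R : realType) (D : set (R * R))
  (b c p q : R * R -> R) (f : R * R -> 'cV[R]_4)
  (D_domain : simply_connected_domain D)
  (b_smooth : smooth D b) (c_smooth : smooth D c)
  (p_smooth : smooth D p) (q_smooth : smooth D q)
  (f_smooth : smooth D f)
  (f_neq0 : forall u, D u -> f u != 0)
  (f_system : forall u, D u -> canonical_system b c p q f u)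
  (f_free : forall u, D u -> free [:: f u; dx f u; dy f u; dy (dx f) u])
  (bc_neq0 : forall u, D u -> b u * c u != 0)
  (demoulin : forall u, D u -> invP b c p u = 0 /\ invQ b c q u = 0)
  (F_SL4 : forall u, D u -> \det (wilczynski_frame b c f u) = 1) :
  let g1 := first_order_gauss_map (wilczynski_frame b c f) in
  [/\ K = [set diag_mx (\row_j [:: k1; k2; k2^-1; k1^-1]`_j)
            | k1 in [set k : R[i] | k != 0] & k2 in [set k : R[i] | k != 0]],
      forall u, D u -> quadrics (g1 u),
      conformal D g1,
      lorentz_harmonic D g1 &
      exists g : R * R -> set 'M[R[i]]_4,
        [/\ forall u, D u -> cosets K (g u),
            lorentz_primitive D g &
            forall u, D u -> proj_K_K1C (g u) = quadric_to_K1C (g1 u)]].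
Proof.
have [_ oD _ _] := D_domain.
split; first exact: KE.
- exact: quadrics_gauss F_SL4.
- exact: conformal_gauss oD b_smooth c_smooth f_smooth f_system bc_neq0 demoulin F_SL4.
- exact: lorentz_harmonic_gauss oD b_smooth c_smooth f_smooth f_system bc_neq0 demoulin F_SL4.
exists (fun u => mulset [set toC_mx (wilczynski_frame b c f u)] K); split.
- move=> u Du; exists (toC_mx (wilczynski_frame b c f u)) => //.
  by rewrite /SL4C /= det_toC_mx F_SL4 // rmorph1.
- exact: frame_primitive oD b_smooth c_smooth f_smooth f_system bc_neq0 demoulin F_SL4.
- by move=> u Du; exact: proj_frame_coset (F_SL4 u Du).
Qed.
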